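(* Let $V:\mathbb{R}^d\to\mathbb{R}$ be a Lipschitz continuous function such that $$\forall\, x\in X\setminus A,\qquad \max \dot V_F(x)<0 .$$ Then for all $a\in\mathbb{R}$ such that $L_a^V\subset X$, it holds that $L_a^V\subset R$, i.e. $$\forall\, x_0\in L_a^V,\qquad \lim_{t\to\infty}\|x(t|x_0)\|=0 .$$
   Context: Setting. $X\subset\mathbb{R}^d$ is a bounded open set and $f:X\to\mathbb{R}^d$ is a vector field. The system is $\dot x=f(x)$ with the constraint $x(t)\in X$ for all $t\ge 0$. $\|\cdot\|$ is the $q$-norm on $\mathbb{R}^d$ for a fixed $q\in[1,\infty]$. Standing assumptions: 1. $f$ is Lipschitz continuous on $X$, and $x(t|x_0)$ denotes the solution at time $t$ with initial condition $x(0)=x_0$. $f$ has a single equilibrium point in $X$, which is the origin $0$, and it is locally asymptotically stable. 2. A finite dataset $D=\{(x_i,f_i)\}_{i=1}^n\subset X\times\mathbb{R}^d$ with $f_i=f(x_i)$ is given. 3. $F:X\rightrightarrows\mathbb{R}^d$ is a set-valued map (constructed from $D$ and side information) such that for all $x\in X$, $F(x)$ is compact and convex and $f(x)\in F(x)$. 4. $A$ is a compact set with $A\subset\mathrm{int}(R)$ and $0\in\mathrm{int}(A)$, where $R$ is the region of attraction: $R=\{x_0\in X : \lim_{t\to\infty}\|x(t|x_0)\|=0\}$ (the trajectory being a solution of the constrained system, i.e. defined and staying in $X$ for all $t\ge 0$). Definitions. $L_a^V=\{x\in\mathbb{R}^d: V(x)<a\}$ is the strict sub-level set. The Clarke generalized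 gradient is $\partial_C V(x)=\mathrm{co}\{g\in\mathbb{R}^d : \forall\varepsilon>0\ \exists x_\varepsilon\in\mathbb{R}^d \text{ with } \|x-x_\varepsilon\|<\varepsilon,\ V \text{ differentiable at } x_\varepsilon,\ \|g-\nabla V(x_\varepsilon)\|<\varepsilon\}$, where $\mathrm{co}$ is the convex hull. The Clarke-Lie derivative of $V$ along $F$ is $\dot V_F(x)=\{v^\top g : v\in F(x),\ g\in\partial_C V(x)\}\subset\mathbb{R}$. *)

(* Defs.v *)
From mathcomp Require Export all_boot all_order all_algebra.
From mathcomp Require Export all_classical all_reals all_analysis.
Export Order.TTheory GRing.Theory Num.Theory.
Export numFieldNormedType.Exports.

Set Implicit Arguments.
Unset Strict Implicit.
Unset Printing Implicit Defensive.

Local Open Scope classical_set_scope.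
Local Open Scope ring_scope.

(* Vectors of R^d are rows.  Topological notions (open, compact, interior,
   bounded, continuous, differentiable) are the library's, which are built on
   the sup norm; they do not depend on the choice of a norm on R^d. *)

(* The value at [-oo] is junk: only [1 <= q] is meant. *)
Definition qnorm {R : realType} {d : nat} (q : \bar R) (x : 'rV[R]_d) : R :=
  match q with
  | r%:E => (\sum_(i < d) `|x ord0 i| `^ r) `^ r^-1
  | +oo%E => \big[Num.max/0]_(i < d) `|x ord0 i|
  | -oo%E => 0
  end.

Definition dot {R : realType} {d : nat} (v g : 'rV[R]_d) : R :=
  (v *m g^T) ord0 ord0.

Definition is_max {R : realType} (S : set R) (m : R) : Prop :=
  S m /\ ubound S m.

Section dynamics.
Context {R : realType} {d : nat} (q : \bar R).
Implicit Types (X : set 'rV[R]_d) (f : 'rV[R]_d -> 'rV[R]_d).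

Definition lipschitz_on_vf X f : Prop :=
  exists K : R, forall x y : 'rV[R]_d, X x -> X y ->
    qnorm q (f x - f y) <= K * qnorm q (x - y).

(* Solutions of the constrained system: defined and in [X] for all [t >= 0].
   Only the restriction of [f] to [X] and of [x] to [0, +oo[ matters; for
   continuous [f] the right derivative at 0 is automatically [f (x 0)]. *)
Definition is_solution X f (x0 : 'rV[R]_d) (x : R -> 'rV[R]_d) : Prop :=
  [/\ x 0 = x0,
      forall t : R, 0 <= t -> X (x t),
      {within `[0, +oo[, continuous x} &
      forall t : R, 0 < t -> is_derive t 1 x (f (x t))].

(* [f] being Lipschitz on [X], a solution from [x0] is unique on [0, +oo[, so
   that quantifying existentially over it amounts to speaking of x(t|x0). *)
Definition region_of_attraction X f : set 'rV[R]_d :=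
  [set x0 | exists2 x : R -> 'rV[R]_d,
      is_solution X f x0 x & qnorm q (x t) @[t --> +oo] --> 0].

Definition origin_stable X f : Prop :=
  forall e : R, 0 < e -> exists2 delta : R, 0 < delta &
    forall x0 : 'rV[R]_d, qnorm q x0 < delta ->
      exists2 x : R -> 'rV[R]_d,
        is_solution X f x0 x & forall t : R, 0 <= t -> qnorm q (x t) < e.

Definition origin_attractive X f : Prop :=
  exists2 delta : R, 0 < delta &
    forall x0 : 'rV[R]_d, qnorm q x0 < delta -> region_of_attraction X f x0.

Definition origin_locally_asymptotically_stable X f : Prop :=
  origin_stable X f /\ origin_attractive X f.

End dynamics.

Section clarke.
Context {R : realType} {d : nat} (q : \bar R).
Implicit Types V : 'rV[R]_d -> R.

Definition lipschitz_fun V : Prop :=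
  exists K : R, forall x y : 'rV[R]_d, `|V x - V y| <= K * qnorm q (x - y).

Definition sublevel V (a : R) : set 'rV[R]_d := [set x | V x < a].

Definition gradient V (x : 'rV[R]_d) : 'rV[R]_d :=
  \row_(i < d) 'D_(delta_mx ord0 i) V x.

Definition convex_hull (S : set 'rV[R]_d) : set 'rV[R]_d :=
  smallest (fun C : set 'rV[R]_d => convex_set C) S.

Definition clarke_gradient V (x : 'rV[R]_d) : set 'rV[R]_d :=
  convex_hull [set g | forall e : R, 0 < e -> exists y : 'rV[R]_d,
    [/\ qnorm q (x - y) < e, differentiable V y &
        qnorm q (g - gradient V y) < e]].

Definition clarke_lie V (F : 'rV[R]_d -> set 'rV[R]_d) (x : 'rV[R]_d) :
    set R :=
  [set dot v g | v in F x & g in clarke_gradient V x].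

End clarke.

(* Main.v *)
(** Along the flow, a Lipschitz [V] satisfies
    [V (x (t + s)) <= V (x t + s f (x t)) + o(s)], so everything rests on a mean
    value inequality: if [<v, grad V>] is at most [m] at all the points of
    differentiability of [V] near [x], then [V (x + s v) - V x <= m s] for small
    [s >= 0]. It follows from Rademacher's theorem and Fubini's theorem: almost
    every line parallel to [v] meets the points of non-differentiability in a
    null set.

    On the compact set [C] of the points of [{V <= V x0}] outside the interior of
    the region of attraction, the hypothesis then bounds the slope of [V] along
    [f] away from 0, by compactness. Hence a trajectory that never enters the
    interior of the region of attraction stays in [C] while [V] decreases at least
    linearly, contradicting the boundedness of [V] on [C]. *)
From HB Require Import structures.
Require Import Defs.
From mathcomp Require Import ring lra.

Set Implicit Arguments.
Unset Strict Implicit.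
Unset Printing Implicit Defensive.

Local Open Scope classical_set_scope.
Local Open Scope ring_scope.

(** * Lipschitz functions on the line *)

(** A trajectory may run entirely inside the null set where [V] is not differentiable, so no chain
    rule is available along it; a straight segment, by contrast, can be shifted to a generic
    parallel one at a cost controlled by the Lipschitz constant. Neither global existence nor
    permanence in [X] is assumed for the trajectory: [f] is extended from [X] to a globally
    Lipschitz field, whose solutions are global, and permanence is proved together with the decrease
    of [V]. Since [V x0] is strictly below [a], the closed sublevel set at [V x0] still lies in [X];
    removing the interior of the region of attraction rather than [A] keeps [C] closed, and it
    removes the origin, so that the field has a nonzero direction on [C]. *)

Lemma lebesgue_stieltjes_measure_oc (R : realType) (f : cumulative R R)
    (x y : R) : x <= y ->
  lebesgue_stieltjes_measure f `]x, y] = (f y - f x)%:E.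
Proof.
move=> xy; rewrite /lebesgue_stieltjes_measure/measure_extension/=.
by rewrite measurable_mu_extE/= ?wlength_itv_bnd//; exact: is_ocitv.
Qed.

(* The Stieltjes measures of [G] and [H] sum to [M] times Lebesgue measure, so
   that the former is absolutely continuous. *)
Lemma cumulative_density (R : realType) (G H : cumulative R R) (M a b : R) :
  0 < M -> a <= b -> (forall t, H t = M * t - G t) ->
  exists rho : R -> R,
    lebesgue_measure.-integrable setT (EFin \o rho) /\
    forall x, a <= x <= b ->
      G x - G a = (\int[lebesgue_measure]_(t in `]a, x]) rho t)%R.
Proof.
move=> M0 ab HE.
pose mG : {measure set (measurableTypeR R) -> \bar R} := lebesgue_stieltjes_measure G.
pose mH : {measure set (measurableTypeR R) -> \bar R} := lebesgue_stieltjes_measure H.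
have mGE (x y : R) : x <= y -> mG `]x, y]%classic = (G y - G x)%:E.
  exact: lebesgue_stieltjes_measure_oc.
have mHE (x y : R) : x <= y -> mH `]x, y]%classic = (H y - H x)%:E.
  exact: lebesgue_stieltjes_measure_oc.
have Mi0 : 0 <= M^-1 by rewrite invr_ge0 ltW.
pose mm := mscale (NngNum Mi0) (measure_add mG mH).
have mmE A : mm A = (M^-1%:E * (mG A + mH A))%E.
  by rewrite -measure_addE.
have lamE A : measurable A -> lebesgue_measure A = mm A.
  apply: lebesgue_measure_unique => X /ocitvP[->|[[x y]/= xy ->]].
    by rewrite !measure0.
  rewrite -[RHS]/(mm _) mmE mGE ?ltW// mHE ?ltW//.
  rewrite lebesgue_measure_itv/= lte_fin xy -!EFinD -EFinM; congr EFin.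
  by rewrite !HE; field; rewrite gt_eqF.
have dom A : measurable A -> lebesgue_measure A = 0 -> mG A = 0%E.
  move=> mA; rewrite lamE// mmE => /eqP.
  rewrite mule_eq0 eqe invr_eq0 (gt_eqF M0)/= => /eqP h.
  by apply/eqP; rewrite eq_le measure_ge0 andbT -h leeDl.
have mab : measurable (`]a, b]%classic : set R) by exact: measurable_itv.
have fab : (mG `]a, b]%classic < +oo)%E by rewrite mGE// ltry.
(* Radon-Nikodym is applied to a finite measure, hence the restriction to ]a, b]. *)
pose nu : {finite_measure set (measurableTypeR R) -> \bar R} :=
  @mfrestr _ (measurableTypeR R) R _ mG mab fab.
have nulam : nu `<< (@lebesgue_measure R).
  apply/null_content_dominatesP => A mA A0.
  rewrite /nu/= /mfrestr/mrestr/=; apply: dom; first exact: measurableI.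
  apply/eqP; rewrite eq_le measure_ge0 andbT -A0.
  by apply: le_measure; rewrite ?inE//; exact: measurableI.
pose f := Radon_Nikodym_SigmaFinite.f nu (@lebesgue_measure R).
have ff x : f x \is a fin_num by exact: Radon_Nikodym_SigmaFinite.f_fin_num.
exists (fine \o f).
have fE : EFin \o (fine \o f) = f by apply/funext => x; rewrite /= fineK.
split; first by rewrite fE; exact: Radon_Nikodym_SigmaFinite.f_integrable.
move=> x /andP[ax xb].
rewrite /Rintegral -[RHS]/(fine _).
have -> : (\int[lebesgue_measure]_(t in `]a, x]) ((fine \o f) t)%:E)%E
   = nu `]a, x]%classic.
  rewrite (Radon_Nikodym_SigmaFinite.f_integral nulam); last exact: measurable_itv.
  by apply: eq_integral => t _; rewrite /= fineK.
rewrite /nu/= /mfrestr/mrestr/= -[G x - G a]/(fine (G x - G a)%:E) -mGE//.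
congr (fine (mG _)); apply/seteqP; split => t /=.
  by rewrite !in_itv/= => /andP[-> tx]; rewrite tx/= (le_trans tx).
by move=> [].
Qed.

(** The upper bound on the increments is what makes [M * t - G t] nondecreasing, hence a cumulative
    function like [G]. *)
Lemma lipschitz_monotone_density (R : realType) (G : R -> R) (M a b : R) :
  0 < M -> a <= b ->
  (forall x y, x <= y -> 0 <= G y - G x <= M * (y - x)) ->
  exists rho : R -> R,
    lebesgue_measure.-integrable setT (EFin \o rho) /\
    forall x, a <= x <= b ->
      G x - G a = (\int[lebesgue_measure]_(t in `]a, x]) rho t)%R.
Proof.
move=> M0 ab HG.
have cont_lip (H : R -> R) : (forall x y, x <= y -> 0 <= H y - H x <= M * (y - x)) ->
    continuous H.
  move=> HH x; apply/(@cvgrPdist_le _ R^o) => e e0; near=> y.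
  have [xy|/ltW yx] := leP x y.
    have /andP[h1 h2] := HH _ _ xy.
    rewrite distrC ger0_norm//; apply: (le_trans h2).
    rewrite mulrC -ler_pdivlMr// -(ger0_norm (_ : 0 <= y - x)) ?subr_ge0// distrC.
    near: y; apply: cvgr_dist_le => //; exact: divr_gt0.
  have /andP[h1 h2] := HH _ _ yx.
  rewrite ger0_norm//; apply: (le_trans h2).
  rewrite mulrC -ler_pdivlMr// -(ger0_norm (_ : 0 <= x - y)) ?subr_ge0//.
  near: y; apply: cvgr_dist_le => //; exact: divr_gt0.
pose H (t : R) := M * t - G t.
have HH x y : x <= y -> 0 <= H y - H x <= M * (y - x).
  by move=> xy; have /andP[h1 h2] := HG _ _ xy; rewrite /H; apply/andP; split; lra.
have ndG : nondecreasing G.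
  by move=> x y xy; have /andP[h1 h2] := HG _ _ xy; rewrite -subr_ge0.
have ndH : nondecreasing H.
  by move=> x y xy; have /andP[h1 h2] := HH _ _ xy; rewrite -subr_ge0.
pose cG : cumulative R R := HB.pack G (isCumulative.Build R _ R G ndG
  (right_continuousW (cont_lip _ HG))).
pose cH : cumulative R R := HB.pack H (isCumulative.Build R _ R H ndH
  (right_continuousW (cont_lip _ HH))).
by apply: (@cumulative_density _ cG cH M).
Unshelve. all: by end_near. Qed.

(** Adding [K * t] makes a Lipschitz function nondecreasing with slopes between 0 and 2K, whence the
    shift by [K] in the conclusion. The negligible set comes from Lebesgue's differentiation
    theorem. *)
Lemma lipschitz_density (R : realType) (g : R -> R) (K a b : R) :
  0 < K -> a < b -> (forall x y, `|g x - g y| <= K * `|x - y|) ->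
  exists rho : R -> R, [/\
    lebesgue_measure.-integrable setT (EFin \o rho),
    g b - g a = (\int[lebesgue_measure]_(t in `]a, b]) rho t)%R - K * (b - a) &
    lebesgue_measure.-negligible
      [set x : R | a < x < b /\ ~ is_derive x 1 g (rho x - K)]].
Proof.
move=> K0 ab gK.
pose G (t : R) := g t + K * t.
have GK x y : x <= y -> 0 <= G y - G x <= (2 * K) * (y - x).
  move=> xy; have := gK y x; rewrite (ger0_norm (_ : 0 <= y - x)) ?subr_ge0//.
  by rewrite ler_norml /G => /andP[h1 h2]; apply/andP; split; lra.
have [|rho [irho Grho]] := lipschitz_monotone_density _ (ltW ab) GK.
  by rewrite mulr_gt0.
exists rho; split => //.
  by rewrite -Grho; [rewrite /G; ring|rewrite lexx ltW].
have h1 y : lebesgue_measure.-integrable [set` `]a, y]] (EFin \o rho).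
  exact: (integrableS measurableT).
have h2 : locally_integrable [set: R] rho.
  by apply: open_integrable_locally => //; exact: openT.
have := FTC1 h1 h2; apply: negligibleS => x /= [/andP[ax xb] + Hx]; apply.
have {Hx}[] := Hx ax.
set F := fun x : R => _; rewrite derive1E => dF DF.
(* The integral from [a] is known to agree with the increment of [G] on [a, b] only, which suffices
   near an interior point. *)
have FG : \near x, F x = G x - G a.
  near=> y; rewrite Grho//; apply/andP; split; apply: ltW; near: y.
    exact: lt_nbhsr.
  exact: lt_nbhsl.
have isF : is_derive x 1 F (rho x) by split.
have isG : is_derive x 1 (fun x => G x - G a) (rho x).
  split; first exact: near_eq_derivable FG dF.
  by rewrite -DF; apply/esym/near_eq_derive.
have isL : is_derive x 1 (fun x => K * x - G a) K.
  by apply: is_derive_eq; rewrite subr0 /GRing.scale/= mulr1.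
have -> : g = (fun x => G x - G a) - (fun x => K * x - G a).
  by apply/funext => t; rewrite /G !fctE; ring.
exact: is_deriveB.
Unshelve. all: by end_near. Qed.

Lemma lipschitz_negligible_nonderivable (R : realType) (g : R -> R) (K : R) :
  (forall x y, `|g x - g y| <= K * `|x - y|) ->
  lebesgue_measure.-negligible [set x : R | ~ derivable g x 1].
Proof.
move=> gK.
(* [K] may be zero or negative, whereas the density wants a positive constant. *)
have gK' x y : `|g x - g y| <= (`|K| + 1) * `|x - y|.
  by apply: le_trans (gK _ _) _; rewrite ler_wpM2r// (le_trans (ler_norm _))// lerDl.
have K0 : 0 < `|K| + 1 by rewrite ltr_wpDl.
have H (n : nat) : lebesgue_measure.-negligible [set x : R |
    - n.+1%:R < x < n.+1%:R /\ ~ derivable g x 1].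
  have ab : - n.+1%:R < n.+1%:R :> R by rewrite gtrN// ltr0n.
  have [rho [_ _]] := lipschitz_density K0 ab gK'.
  by apply: negligibleS => x /= [xn ndg]; split=> // -[].
apply: negligibleS (negligible_bigcup H) => x /= ndg.
by exists (Num.truncn `|x|) => //; split => //; rewrite -ltr_norml truncnS_gt.
Qed.

(** By absolute continuity the increment of [g] is the integral of its derivative, to which a null
    set of steep points does not contribute. *)
Lemma lipschitz_slope_le (R : realType) (g : R -> R) (K m a b : R) :
  (forall x y, `|g x - g y| <= K * `|x - y|) -> a <= b ->
  lebesgue_measure.-negligible
    [set x : R | [/\ a < x < b, derivable g x 1 & m < 'D_1 g x]] ->
  g b - g a <= m * (b - a).
Proof.
move=> gK; rewrite le_eqVlt => /predU1P[->|ab]; first by rewrite !subrr mulr0.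
move=> gm.
have gK' x y : `|g x - g y| <= (`|K| + 1) * `|x - y|.
  by apply: le_trans (gK _ _) _; rewrite ler_wpM2r// (le_trans (ler_norm _))// lerDl.
have K0 : 0 < `|K| + 1 by rewrite ltr_wpDl.
set K' := `|K| + 1 in K0 gK'.
have [rho [irho -> drho]] := lipschitz_density K0 ab gK'.
have irho' : lebesgue_measure.-integrable `]a, b] (EFin \o rho).
  exact: (integrableS measurableT).
have icst : lebesgue_measure.-integrable `]a, b] (EFin \o cst (m + K')).
  apply: (@integrableS _ _ _ lebesgue_measure `[a, b]).
  - exact: measurable_itv.
  - exact: measurable_itv.
  - exact: subset_itv_oc_cc.
  apply: continuous_compact_integrable; first exact: segment_compact.
  by apply: continuous_subspaceT => x; exact: cst_continuous.
have mb : @measurable _ (measurableTypeR R) `]a, b]%classic by exact: measurable_itv.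
have mrho := measurable_int _ irho'.
(* Truncating [rho] at [m + K'] changes it on a null set only, and gives a bound valid at every
   point, as monotonicity of the integral requires. *)
have imin : lebesgue_measure.-integrable `]a, b]
    (EFin \o (fun t => Num.min (rho t) (m + K'))).
  have := integrableD mb (integrable_abse irho') (integrable_abse icst).
  apply: le_integrable => //.
    have -> : EFin \o (fun t => Num.min (rho t) (m + K')) =
        fun t => mine (rho t)%:E (m + K')%:E.
      by apply/funext => t /=; rewrite EFin_min.
    exact: measurable_realfun.measurable_mine.
  move=> t _ /=; rewrite lee_fin [leRHS]ger0_norm ?addr_ge0//.
  by rewrite /Num.min; case: ifP => _; rewrite ?lerDl ?lerDr.
rewrite lerBlDr -mulrDl.
have nb : lebesgue_measure.-negligible [set b].
  exists [set b]; split => //; last exact: lebesgue_measure_set1.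
have -> : (\int[lebesgue_measure]_(t in `]a, b]) rho t)%R =
    (\int[lebesgue_measure]_(t in `]a, b]) Num.min (rho t) (m + K'))%R.
  congr fine; apply: ae_eq_integral.
  - exact: measurable_itv.
  - exact: measurable_int irho'.
  - exact: measurable_int imin.
  apply: negligibleS (negligibleU (negligibleU gm drho) nb).
  move=> t /= tab.
  have {}tab : t \in `]a, b] /\ m + K' < rho t.
    split; first by apply/negP => h; apply: tab.
    rewrite ltNge; apply/negP => h; apply: tab => _; congr EFin.
    by rewrite min_l.
  have {tab}[] := tab; rewrite in_itv/= => /andP[a_t].
  rewrite le_eqVlt => /predU1P[->|tb] mt; first by right.
  left; have [[dg gE]|] := pselect (is_derive t 1 g (rho t - K')); last first.
    by right; split => //; rewrite a_t.
  by left; split; rewrite ?a_t// gE ltrBrDr.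
apply: (@le_trans _ _ (\int[lebesgue_measure]_(t in `]a, b]) cst (m + K') t)%R).
  apply: le_Rintegral => //.
  by move=> t _; rewrite ge_min lexx orbT.
have -> : b - a = fine (lebesgue_measure `]a, b]%classic).
  by rewrite lebesgue_measure_itv/= lte_fin ab.
by rewrite Rintegral_cst.
Qed.

(** * Null sets for iterated Lebesgue measure *)

Lemma rV_norm_le (R : realType) n (x : 'rV[R]_n) (r : R) : 0 <= r ->
  (forall i, `|x ord0 i| <= r) -> `|x| <= r.
Proof.
move=> r0 H; rewrite /Num.norm/= mx_normrE; apply/bigmax_leP; split => // -[i j] _.
by rewrite (ord1 i); exact: H.
Qed.

Lemma rV_norm_ge (R : realType) n (x : 'rV[R]_n) i : `|x ord0 i| <= `|x|.
Proof.
by rewrite [leRHS]/Num.norm/= mx_normrE (le_bigmax _ _ (ord0, i)).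
Qed.

Lemma rV_ball (R : realType) n (x y : 'rV[R]_n) (r : R) : 0 < r ->
  ball x r y <-> forall i, ball (x ord0 i) r (y ord0 i).
Proof.
move=> r0; split => [[_ h] i|h]; first exact: h.
by split => // i j; rewrite (ord1 i).
Qed.

(** * Borel sets, and measurability through coordinates *)

Definition borel (T : topologicalType) : set (set T) := <<s @open T >>.
Arguments borel {T}.

Lemma borel_open (T : topologicalType) (S : set T) : open S -> borel S.
Proof. exact: sub_sigma_algebra. Qed.

Lemma borelC (T : topologicalType) (S : set T) : borel S -> borel (~` S).
Proof.
by have [_ + _] := smallest_sigma_algebra [set: T] open; rewrite -setTD; exact.
Qed.

Lemma borel_closed (T : topologicalType) (S : set T) : closed S -> borel S.
Proof.
move=> /closed_openC oS; rewrite -(setCK S).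
by apply: borelC; apply: borel_open.
Qed.

Lemma borel_bigcup (T : topologicalType) (S : nat -> set T) :
  (forall k, borel (S k)) -> borel (\bigcup_k S k).
Proof. by have [_ _] := smallest_sigma_algebra [set: T] open; exact. Qed.

Lemma borel_bigcap (T : topologicalType) (S : nat -> set T) :
  (forall k, borel (S k)) -> borel (\bigcap_k S k).
Proof.
move=> bS; rewrite -(setCK (\bigcap_k _)) setC_bigcap; apply: borelC.
by apply: borel_bigcup => k; exact: borelC.
Qed.

Lemma borel_preimage (T U : topologicalType) (f : T -> U) (S : set U) :
  continuous f -> borel S -> borel (f @^-1` S).
Proof.
move=> cf; suff: borel `<=` [set S | borel (f @^-1` S)] by exact.
apply: smallest_sub => [|O oO]; last first.
  by apply: borel_open; apply: open_comp => // x _; exact: cf.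
split => [|A bA|A bA] /=.
- by rewrite preimage_set0; have [] := smallest_sigma_algebra [set: T] open.
- by rewrite setTD preimage_setC; exact: borelC.
- by rewrite preimage_bigcup; exact: borel_bigcup.
Qed.

(** An open set is a countable union of cubes with rational centres, and the preimage of a cube is a
    finite intersection of preimages of intervals. *)
Lemma measurable_preimage_borel d (T : measurableType d) (R : realType) n
    (phi : T -> 'rV[R]_n) (S : set 'rV[R]_n) :
  (forall i, measurable_fun setT (fun t => phi t ord0 i)) -> borel S ->
  measurable (phi @^-1` S).
Proof.
move=> mphi; suff: borel `<=` [set S | measurable (phi @^-1` S)] by exact.
apply: smallest_sub => [|O oO] /=.
  split => [|A bA|A bA] /=.
  - by rewrite preimage_set0.
  - by rewrite setTD preimage_setC; exact: measurableC.
  - by rewrite preimage_bigcup; exact: bigcupT_measurable.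
pose B (p : 'rV[rat]_n * nat) : set 'rV[R]_n :=
  [set y | forall i, ball (ratr (p.1 ord0 i) : R) p.2.+1%:R^-1 (y ord0 i)].
have mB p : measurable (phi @^-1` B p).
  have -> : phi @^-1` B p = \bigcap_(i in [set: 'I_n])
      ((fun t => phi t ord0 i) @^-1` ball (ratr (p.1 ord0 i) : R) p.2.+1%:R^-1).
    by apply/seteqP; split => t /= H i; [move=> _|]; apply: H.
  apply: fin_bigcap_measurable => // i _; rewrite -[X in measurable X]setTI.
  by apply: mphi => //; exact: measurable_realfun.measurable_ball.
(* The condition that the cube lies in [O] is coded as a set that is everything or empty, so that
   the union runs over a whole countable type. *)
have -> : phi @^-1` O = \bigcup_p (phi @^-1` B p `&` [set _ | B p `<=` O]).
  apply/seteqP; split => [t /= Ot|t [p _ [/= Bp]]]; last exact.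
  have /nbhs_ballP[e /= e0 eO] : nbhs (phi t) O by exact: open_nbhs_nbhs.
  have [k ke] : exists k : nat, k.+1%:R^-1 + k.+1%:R^-1 < e.
    exists (Num.truncn (2 / e)); rewrite -mulr2n -[X in X < _]mulr_natl.
    by rewrite ltr_pdivrMr// -ltr_pdivrMl// mulrC truncnS_gt.
  have k0 : 0 < k.+1%:R^-1 :> R by [].
  have /choice[q qH] : forall i : 'I_n, exists q : rat,
      ball (ratr q : R) k.+1%:R^-1 (phi t ord0 i).
    move=> i; have [|q] := @rat_in_itvoo R (phi t ord0 i) (phi t ord0 i + k.+1%:R^-1).
      by rewrite ltrDl.
    rewrite in_itv/= => /andP[q1 q2]; exists q.
    by rewrite /ball/= gtr0_norm ?subr_gt0// ltrBlDl.
  exists (\row_i q i, k) => //; split => [i|y] /=; first by rewrite mxE.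
  move=> By; apply: eO; apply/rV_ball => // i.
  have := By i; rewrite mxE => /= h; apply: le_ball (ltW ke) _ _.
  by apply: ball_triangle h; exact/ball_sym/qH.
apply: countable_bigcupT_measurable => [|p]; first exact: countableP.
have [BO|BO] := pselect (B p `<=` O).
  suff -> : [set _ | B p `<=` O] = [set: T] by rewrite setIT.
  by apply/seteqP; split.
suff -> : [set _ | B p `<=` O] = set0 :> set T by rewrite setI0.
by apply/seteqP; split.
Qed.

(** * Splitting off the first coordinate *)

Definition rV_cons (R : realType) n (t : R) (u : 'rV[R]_n) : 'rV[R]_n.+1 :=
  \row_i oapp (u ord0) t (unlift ord0 i).

Lemma rV_cons0 (R : realType) n (t : R) (u : 'rV[R]_n) :
  rV_cons t u ord0 ord0 = t.
Proof. by rewrite mxE unlift_none. Qed.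

Lemma rV_consS (R : realType) n (t : R) (u : 'rV[R]_n) i :
  rV_cons t u ord0 (lift ord0 i) = u ord0 i.
Proof. by rewrite mxE liftK. Qed.

Lemma rV_cons_eta (R : realType) n (x : 'rV[R]_n.+1) :
  x = rV_cons (x ord0 ord0) (\row_i x ord0 (lift ord0 i)).
Proof.
apply/rowP => i; case: (unliftP ord0 i) => [j|] ->.
  by rewrite rV_consS mxE.
by rewrite rV_cons0.
Qed.

Lemma rV_consD (R : realType) n (t s : R) (u v : 'rV[R]_n) :
  rV_cons t u + rV_cons s v = rV_cons (t + s) (u + v).
Proof.
by apply/rowP => i; rewrite mxE; case: (unliftP ord0 i) => [j|] ->;
  rewrite ?rV_consS ?rV_cons0 ?mxE.
Qed.

Lemma rV_cons_delta0 (R : realType) n (t : R) :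
  rV_cons t 0 = t *: delta_mx ord0 ord0 :> 'rV[R]_n.+1.
Proof.
apply/rowP => i; case: (unliftP ord0 i) => [j|] ->.
  by rewrite rV_consS !mxE eqxx/= mulr0.
by rewrite rV_cons0 !mxE eqxx mulr1.
Qed.

Lemma rV_cons_deltaS (R : realType) n (t : R) j :
  rV_cons 0 (t *: delta_mx ord0 j) = t *: delta_mx ord0 (lift ord0 j)
  :> 'rV[R]_n.+1.
Proof.
apply/rowP => i; case: (unliftP ord0 i) => [k|] ->.
  by rewrite rV_consS !mxE eqxx/= (inj_eq (@lift_inj _ ord0)).
by rewrite rV_cons0 !mxE eqxx/= mulr0.
Qed.

Lemma rV_cons_ball (R : realType) n (x : 'rV[R]_n.+1) t u (r : R) : 0 < r ->
  ball x r (rV_cons t u) <->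
  ball (x ord0 ord0) r t /\ ball (\row_i x ord0 (lift ord0 i)) r u.
Proof.
move=> r0; split=> [/(rV_ball _ _ r0) h|[h0 /(rV_ball _ _ r0) h]].
  split; first by have := h ord0; rewrite rV_cons0.
  by apply/rV_ball => // i; have := h (lift ord0 i); rewrite rV_consS mxE.
apply/rV_ball => // i; case: (unliftP ord0 i) => [k|] ->.
  by have := h k; rewrite rV_consS mxE.
by rewrite rV_cons0.
Qed.

Lemma rV_cons_continuous (R : realType) n (t : R) :
  continuous (@rV_cons R n t).
Proof.
move=> u; apply/(@cvgrPdist_le _ _ _ _ (nbhs_filter u)) => e e0; near=> v.
apply: rV_norm_le; first exact: ltW.
move=> i; rewrite mxE [in X in _ + X]mxE; case: (unliftP ord0 i) => [k|] ->.
  rewrite !rV_consS; apply: le_trans (_ : `|u - v| <= _); last first.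
    by near: v; exact: cvgr_dist_le.
  by have := rV_norm_ge (u - v) k; rewrite !mxE.
by rewrite !rV_cons0 subrr normr0 ltW.
Unshelve. all: by end_near. Qed.

(* [mu] transported along [phi] plays the role of Lebesgue measure on [R^n]. *)
Definition lebesgue_like (R : realType) n d (T : measurableType d)
    (mu : set T -> \bar R) (phi : T -> 'rV[R]_n) :=
  [/\ forall i, measurable_fun setT (fun t => phi t ord0 i),
      forall x r, 0 < r -> (0 < mu (phi @^-1` ball x r))%E &
      forall i (S : set 'rV[R]_n), borel S ->
        (forall x, lebesgue_measure.-negligible
           [set t : R | S (x + t *: delta_mx ord0 i)]) ->
        mu (phi @^-1` S) = 0%E].

(** Tonelli, with an order of integration that depends on the direction of the lines along which [S]
    is null. *)
Lemma lebesgue_like_cons (R : realType) n d (T : measurableType d)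
    (mu : {sigma_finite_measure set T -> \bar R}) (phi : T -> 'rV[R]_n) :
  lebesgue_like mu phi ->
  lebesgue_like ((@lebesgue_measure R) \x mu)%E
    (fun p => rV_cons p.1 (phi p.2) : 'rV[R]_n.+1).
Proof.
move=> [mphi muball muline].
have mcons i : measurable_fun setT
    (fun p : measurableTypeR R * T => rV_cons p.1 (phi p.2) ord0 i).
  case: (unliftP ord0 i) => [k|] ->.
    apply: (eq_measurable_fun (fun p => phi p.2 ord0 k)).
      by move=> p _; rewrite rV_consS.
    apply: (measurableT_comp (mphi k)); exact: measurable_snd.
  apply: (eq_measurable_fun fst); first by move=> p _; rewrite rV_cons0.
  exact: measurable_fst.
split => //.
- move=> x r r0; pose u : 'rV[R]_n := \row_i x ord0 (lift ord0 i).
  have -> : (fun p => rV_cons p.1 (phi p.2)) @^-1` ball x r =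
      (ball (x ord0 ord0) r) `*` (phi @^-1` ball u r).
    apply/seteqP; split => [p/= /(rV_cons_ball _ _ _ r0)//|p/= ?].
    exact/(rV_cons_ball _ _ _ r0).
  rewrite product_measure1E//.
  - apply: mule_gt0; last exact: muball.
    rewrite -[X in (0 < X)%E]/(lebesgue_measure (ball (x ord0 ord0) r)).
    by rewrite lebesgue_measure_ball ?ltW// lte_fin mulr2n addr_gt0.
  - exact: measurable_realfun.measurable_ball.
  - by apply: measurable_preimage_borel => //; apply: borel_open; exact: ball_open.
- move=> i S bS Sline; have mS := measurable_preimage_borel mcons bS.
  case: (unliftP ord0 i) Sline => [k|] -> Sline.
    (* Other directions: with the first coordinate frozen, the property of [mu] in dimension [n]
       applies to the section. *)
    apply: integral0_eq => t _ /=.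
    have -> : xsection ((fun p : R * T => rV_cons p.1 (phi p.2)) @^-1` S) t =
        phi @^-1` (rV_cons t @^-1` S).
      by apply/seteqP; split => z; rewrite /xsection/= inE.
    apply: (muline k).
      by apply: borel_preimage bS; exact: rV_cons_continuous.
    move=> x; apply: negligibleS (Sline (rV_cons t x)) => s /=.
    by rewrite -rV_cons_deltaS rV_consD addr0.
  (* First direction: the order of integration is exchanged, so that the inner sections are lines
     parallel to the first axis. *)
  have -> : ((@lebesgue_measure R) \x mu)%E
      ((fun p => rV_cons p.1 (phi p.2)) @^-1` S) =
    ((@lebesgue_measure R) \x^ mu)%E
      ((fun p => rV_cons p.1 (phi p.2)) @^-1` S).
    by apply: product_measure_unique => // A B mA mB; exact: product_measure2E.
  apply: integral0_eq => z _ /=; apply: measure_negligible.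
    exact: measurable_ysection.
  apply: negligibleS (Sline (rV_cons 0 (phi z))) => s.
  by rewrite /ysection/= inE/= -rV_cons_delta0 rV_consD add0r addr0.
Qed.

Lemma sigma_finite_product (R : realType) d1 d2 (T1 : measurableType d1)
    (T2 : measurableType d2) (m1 : {sigma_finite_measure set T1 -> \bar R})
    (m2 : {sigma_finite_measure set T2 -> \bar R}) :
  sigma_finite setT (m1 \x m2)%E.
Proof.
have [F TF Foo] := sigma_finiteT m1; have [G TG Goo] := sigma_finiteT m2.
exists (fun k => if unpickle k is Some (i, j) then F i `*` G j else set0).
  apply/esym; rewrite -subTset => -[x y] _.
  have : setT x by []; rewrite TF => -[i _ Fx].
  have : setT y by []; rewrite TG => -[j _ Gy].
  by exists (pickle (i, j)) => //; rewrite pickleK.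
move=> k; case: unpickle => [[i j]|]; last by rewrite measure0.
have [mF F_fin] := Foo i; have [mG G_fin] := Goo j.
split; first exact: measurableX.
by rewrite product_measure1E// lte_mul_pinfty// ge0_fin_numE.
Qed.

(** Iterated products with the line, starting from a Dirac mass on a point, the zero-dimensional
    Lebesgue measure. Sigma-finiteness is carried along because the next product needs it. *)
Lemma lebesgue_like_exists (R : realType) n :
  exists (d : measure_display) (T : measurableType d)
    (mu : {sigma_finite_measure set T -> \bar R}) (phi : T -> 'rV[R]_n),
    lebesgue_like mu phi.
Proof.
elim: n => [|n [d [T [mu [phi H]]]]].
  exists _, unit, (\d_tt : {sigma_finite_measure set unit -> \bar R}), (fun=> 0).
  split; [by case|move=> x r r0|by case].
  rewrite -[X in (0 < X)%E]/(\d_tt ((fun=> 0) @^-1` ball x r)) diracE.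
  by rewrite mem_set ?lte01//= (thinmx0 x); exact: ballxx.
pose mm := HB.pack_for
  {sigma_finite_measure set (measurableTypeR R * T)%type -> \bar R}
  (product_measure1 (@lebesgue_measure R) mu)
  (Measure_isSigmaFinite.Build _ _ _ (lebesgue_measure \x mu)%E
    (sigma_finite_product (@lebesgue_measure R) mu)).
exists _, (measurableTypeR R * T)%type, mm, (fun p => rV_cons p.1 (phi p.2)).
exact: lebesgue_like_cons.
Qed.

(** * Rademacher's theorem *)

(** The norm is the sup norm, in which all estimates are made; [lipschitz_fun_lipR] passes to it
    from the [q]-norm. *)
Definition lipR (R : realType) n (K : R) (W : 'rV[R]_n -> R) :=
  forall x y, `|W x - W y| <= K * `|x - y|.

Lemma lipR_continuous (R : realType) n (K : R) (W : 'rV[R]_n -> R) :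
  lipR K W -> continuous W.
Proof.
move=> WK x; apply/(@cvgrPdist_le _ _ _ _ (nbhs_filter x)) => e e0.
have K1 : 0 < `|K| + 1 by rewrite ltr_wpDl.
near=> y; apply: le_trans (WK x y) _.
apply: (@le_trans _ _ ((`|K| + 1) * `|x - y|)).
  by rewrite ler_wpM2r// (le_trans (ler_norm _))// lerDl.
rewrite mulrC -ler_pdivlMr//; near: y; apply: cvgr_dist_le => //.
exact: divr_gt0.
Unshelve. all: by end_near. Qed.

Lemma closed_sublevel (R : realType) (T : topologicalType) (f : T -> R) (c : R) :
  continuous f -> closed [set x | f x <= c].
Proof.
move=> cf; have := @preimage_closed T R f [set z | z <= c].
by apply; [move=> x _; exact: cf|exact: closed_le].
Qed.

(** A uniform bound on difference quotients, multiplied out so that [s = 0] is harmless and the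
    condition is closed in [x]. *)
Definition slope_set (R : realType) n (W : 'rV[R]_n -> R) (v : 'rV[R]_n)
    (r e d : R) : set 'rV[R]_n :=
  [set x | forall s, `|s| <= d -> `|W (x + s *: v) - W x - r * s| <= e * `|s|].

Lemma closed_slope_set (R : realType) n (W : 'rV[R]_n -> R) (v : 'rV[R]_n)
    (r e d : R) : continuous W -> closed (slope_set W v r e d).
Proof.
move=> cW.
have -> : slope_set W v r e d = \bigcap_(s in [set s | `|s| <= d])
    [set x | `|W (x + s *: v) - W x - r * s| <= e * `|s|].
  by apply/seteqP; split => x /= H s sd; apply: H.
apply: closed_bigI => s _.
apply: closed_sublevel => x.
have c1 : {for x, continuous (fun y : 'rV[R]_n => W (y + s *: v))}.
  apply: (@continuous_comp _ _ _ (fun y : 'rV[R]_n => y + s *: v)); last exact: cW.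
  by apply: continuousD; [move=> A; exact|exact: cst_continuous].
apply: (@continuous_comp _ _ _ (fun y : 'rV[R]_n => W (y + s *: v) - W y - r * s)); last first.
  exact: norm_continuous.
apply: continuousB; last exact: cst_continuous.
by apply: continuousB; [exact: c1|exact: cW].
Qed.

Lemma slope_set_cvg (R : realType) n (W : 'rV[R]_n -> R) (v x : 'rV[R]_n)
    (r e d : R) : 0 < d -> slope_set W v r e d x ->
  \forall h \near 0^', `|h^-1 *: (W (h *: v + x) - W x) - r| <= e.
Proof.
move=> d0 H; near=> h.
have h0 : h != 0 by near: h; exact: nbhs_dnbhs_neq.
have hd : `|h| <= d.
  near: h; apply: (@dnbhs0_le _ R^o) => //.
have := H h hd; rewrite [x + _]addrC => {}H.
have -> : h^-1 *: (W (h *: v + x) - W x) - r =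
    h^-1 * (W (h *: v + x) - W x - r * h).
  by rewrite /GRing.scale/=; field.
by rewrite normrM normrV ?unitfE// mulrC ler_pdivrMr ?normr_gt0.
Unshelve. all: by end_near. Qed.

Lemma slope_set_derive (R : realType) n (W : 'rV[R]_n -> R) (v x : 'rV[R]_n)
    (r e d : R) : 0 < d -> slope_set W v r e d x -> derivable W x v ->
  `|'D_v W x - r| <= e.
Proof.
move=> d0 H dW; have := slope_set_cvg d0 H => {}H.
apply/ler_addgt0Pl => z z0.
have Hz : \forall h \near 0^', `|'D_v W x - h^-1 *: (W (h *: v + x) - W x)| <= z.
  by apply: cvgr_dist_le z0.
have [h [h1 h2]] := filter_ex (filterI H Hz).
apply: le_trans (ler_distD (h^-1 *: (W (h *: v + x) - W x)) _ _) _.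
by rewrite lerD.
Qed.

Lemma derivable_slope_set (R : realType) n (W : 'rV[R]_n -> R)
    (v x : 'rV[R]_n) (e : R) : 0 < e -> derivable W x v ->
  exists (q : rat) (k : nat), slope_set W v (ratr q) e k.+1%:R^-1 x.
Proof.
move=> e0 dW.
have [q] := @rat_in_itvoo R ('D_v W x) ('D_v W x + e / 2) ltac:(by rewrite ltrDl divr_gt0).
rewrite in_itv/= => /andP[q1 q2].
have : \forall h \near 0^', `|'D_v W x - h^-1 *: (W (h *: v + x) - W x)| <= e / 2.
  by apply: cvgr_dist_le => //; exact: divr_gt0.
move=> [/= d d0 Hd].
exists q, (Num.truncn d^-1) => s sk.
have [->|s0] := eqVneq s 0.
  by rewrite scale0r addr0 mulr0 subrr subr0 normr0 mulr0.
have sd : `|s| < d.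
  apply: le_lt_trans sk _; rewrite invf_plt ?posrE//.
  by rewrite truncnS_gt.
have := Hd s; rewrite /ball_/= sub0r normrN => /(_ sd s0) H.
have -> : W (x + s *: v) - W x - ratr q * s =
    (s^-1 *: (W (s *: v + x) - W x) - ratr q) * s.
  by rewrite [x + _]addrC /GRing.scale/=; field.
rewrite normrM ler_wpM2r//.
move: H; rewrite !ler_norml => /andP[h1 h2]; apply/andP; split; lra.
Qed.

(** The Cauchy criterion with countably many parameters; with closed slope sets it shows that the
    points of derivability form a Borel set. *)
Lemma derivable_slope_setP (R : realType) n (W : 'rV[R]_n -> R)
    (v x : 'rV[R]_n) : derivable W x v <->
  forall m : nat, exists (q : rat) (k : nat),
    slope_set W v (ratr q) m.+1%:R^-1 k.+1%:R^-1 x.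
Proof.
split=> [dW m|H]; first exact: derivable_slope_set.
apply/cauchy_cvgP; apply/cauchy_exP => e e0.
have [m me] : exists m : nat, m.+1%:R^-1 < e.
  by exists (Num.truncn e^-1); rewrite invf_plt ?posrE// truncnS_gt.
have [q [k Hk]] := H m; exists (ratr q).
have : \forall h \near 0^', `|h^-1 *: (W (h *: v + x) - W x) - ratr q| <= m.+1%:R^-1.
  by apply: slope_set_cvg Hk.
apply: filterS => h hm; rewrite /ball/= distrC; exact: le_lt_trans me.
Qed.

Lemma borel_derivable (R : realType) n (W : 'rV[R]_n -> R) (v : 'rV[R]_n) :
  continuous W -> borel [set x | derivable W x v].
Proof.
move=> cW.
have -> : [set x | derivable W x v] = \bigcap_m \bigcup_j
    [set x | if unpickle j is Some (q, k) then
       slope_set W v (ratr q) m.+1%:R^-1 (k : nat).+1%:R^-1 x else False].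
  apply/seteqP; split => [x /derivable_slope_setP H m _|x H].
    by have [q [k qk]] := H m; exists (pickle (q, k)); [exact: I|rewrite /mkset pickleK].
  apply/derivable_slope_setP => m; have [j _] := H m I; rewrite /mkset.
  by case: unpickle => // -[q k] qk; exists q, k.
apply: borel_bigcap => m; apply: borel_bigcup => j.
case: unpickle => [[q k]|].
  by apply: borel_closed; exact: closed_slope_set.
by apply: borel_closed; exact: closed0.
Qed.

Lemma derivable_line (R : realType) n (W : 'rV[R]_n -> R) (x v : 'rV[R]_n)
    (t d : R) :
  is_derive t 1 (fun s => W (x + s *: v)) d <-> is_derive (x + t *: v) v W d.
Proof.
have E : (fun h => h^-1 *: (((fun s => W (x + s *: v)) \o shift t) (h *: 1) -
       W (x + t *: v))) =
   (fun h : R => h^-1 *: ((W \o shift (x + t *: v)) (h *: v) - W (x + t *: v))).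
  apply/funext => h /=; congr (_ *: (W _ - _)).
  by rewrite [h%:A]mulr1 scalerDl addrCA.
split=> -[d1 d2]; split.
- by move: d1; rewrite /derivable E.
- by move: d2; rewrite /derive E.
- by move: d1; rewrite /derivable E.
- by move: d2; rewrite /derive E.
Qed.

Lemma lipR_line (R : realType) n (K : R) (W : 'rV[R]_n -> R) (x v : 'rV[R]_n) :
  lipR K W -> forall s t : R,
  `|W (x + s *: v) - W (x + t *: v)| <= (K * `|v|) * `|s - t|.
Proof.
move=> WK s t; apply: le_trans (WK _ _) _.
by rewrite opprD addrACA subrr add0r -scalerBl normrZ -mulrA [`|v| * _]mulrC.
Qed.

(** On each line of direction [i] the function is Lipschitz in one variable, hence derivable almost
    everywhere; Fubini's theorem is built into [lebesgue_like]. *)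
Lemma lebesgue_like_nonderivable (R : realType) n d (T : measurableType d)
    (mu : {measure set T -> \bar R}) (phi : T -> 'rV[R]_n) (K : R)
    (W : 'rV[R]_n -> R) i : lebesgue_like mu phi -> lipR K W ->
  mu.-negligible [set t | ~ derivable W (phi t) (delta_mx ord0 i)].
Proof.
move=> [mphi _ muline] WK.
have bD : borel (~` [set x | derivable W x (delta_mx ord0 i)]).
  by apply: borelC; apply: borel_derivable; exact: lipR_continuous WK.
exists (phi @^-1` (~` [set x | derivable W x (delta_mx ord0 i)])); split => //.
  exact: measurable_preimage_borel.
apply: (muline i) bD _ => x.
apply: negligibleS (lipschitz_negligible_nonderivable (lipR_line x (delta_mx ord0 i) WK)).
move=> t /= + dt; apply.
have [+ _] := derivable_line W x (delta_mx ord0 i) t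
  ('D_1 (fun s : R => W (x + s *: delta_mx ord0 i)) t).
by case; first split.
Qed.

Lemma dotE (R : realType) n (u v : 'rV[R]_n) :
  dot u v = \sum_i u ord0 i * v ord0 i.
Proof. by rewrite /dot mxE; apply: eq_bigr => i _; rewrite mxE. Qed.

Lemma dotDl (R : realType) n (u v w : 'rV[R]_n) :
  dot (u + v) w = dot u w + dot v w.
Proof. by rewrite /dot mulmxDl mxE. Qed.

Lemma dotZl (R : realType) n (a : R) (u v : 'rV[R]_n) :
  dot (a *: u) v = a * dot u v.
Proof. by rewrite /dot -scalemxAl mxE. Qed.

Lemma dot_deltal (R : realType) n i (v : 'rV[R]_n) :
  dot (delta_mx ord0 i) v = v ord0 i.
Proof. by rewrite /dot -rowE !mxE. Qed.

(** For empty [E] this is the default value of [inf], hence the nonemptiness hypotheses below. *)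
Definition setdist (R : realType) n (E : set 'rV[R]_n) (x : 'rV[R]_n) : R :=
  inf [set `|x - y| | y in E].

Lemma setdist_le (R : realType) n (E : set 'rV[R]_n) (x y : 'rV[R]_n) :
  E y -> setdist E x <= `|x - y|.
Proof.
by move=> Ey; apply: ge_inf; [exists 0 => _ [z _ <-]|exists y].
Qed.

Lemma setdist_ge0 (R : realType) n (E : set 'rV[R]_n) (x : 'rV[R]_n) :
  E !=set0 -> 0 <= setdist E x.
Proof.
by move=> [y Ey]; apply: lb_le_inf => [|_ [z _ <-]//]; exists `|x - y|, y.
Qed.

Lemma setdist0 (R : realType) n (E : set 'rV[R]_n) (x : 'rV[R]_n) :
  E x -> setdist E x = 0.
Proof.
move=> Ex; apply/eqP; rewrite eq_le setdist_ge0 ?andbT; last by exists x.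
by rewrite (le_trans (setdist_le x Ex))// subrr normr0.
Qed.

Lemma setdist_lt (R : realType) n (E : set 'rV[R]_n) (x : 'rV[R]_n) (e : R) :
  E !=set0 -> setdist E x < e -> exists2 y, E y & `|x - y| < e.
Proof.
move=> [y Ey] xe.
have [|_ [z Ez <-] ze] := @inf_lt _ [set `|x - y| | y in E] e _ xe; last by exists z.
by exists `|x - y|, y.
Qed.

Lemma setdist_lipR (R : realType) n (E : set 'rV[R]_n) :
  E !=set0 -> lipR 1 (setdist E).
Proof.
move=> E0.
have H x y : setdist E x - setdist E y <= `|x - y|.
  apply/ler_addgt0Pl => e e0.
  have [z Ez yz] : exists2 z, E z & `|y - z| < setdist E y + e.
    by apply: setdist_lt; rewrite // ltrDl.
  have := setdist_le x Ez; have := ler_distD y x z; lra.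
move=> x y; rewrite mul1r ler_norml H andbT.
by have := H y x; rewrite distrC; lra.
Qed.

(** Frechet differentiability along the span of the first [j] basis vectors, an interpolation
    between no condition and differentiability that serves for induction on [j]. *)
Definition partial_frechet (R : realType) n j (W : 'rV[R]_n -> R)
    (x : 'rV[R]_n) :=
  forall e, 0 < e -> exists2 d, 0 < d & forall h : 'rV[R]_n,
    (forall i : 'I_n, (j <= i)%N -> h ord0 i = 0) -> `|h| <= d ->
    `|W (x + h) - W x - dot h (gradient W x)| <= e * `|h|.

Lemma min_derive0 (R : realType) n (W : 'rV[R]_n -> R) (x v : 'rV[R]_n) :
  derivable W x v -> (forall y, W x <= W y) -> 'D_v W x = 0.
Proof.
move=> dW Wmin.
apply/eqP/negPn/negP => D0.
have : \forall h \near 0^', `|'D_v W x - h^-1 *: (W (h *: v + x) - W x)| <= `|'D_v W x| / 2.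
  by apply: cvgr_dist_le => //; rewrite divr_gt0// normr_gt0.
move=> [/= d d0 Hd].
have d2 : 0 < d / 2 by rewrite divr_gt0.
have d2d : d / 2 < d by lra.
have := Hd (d / 2); rewrite /ball_/= sub0r normrN gtr0_norm// => /(_ d2d (lt0r_neq0 d2)).
have := Hd (- (d / 2)); rewrite /ball_/= sub0r opprK gtr0_norm// oppr_eq0 => /(_ d2d (lt0r_neq0 d2)).
set D := 'D_v W x in D0 *.
set q1 := _ *: _; set q2 := _ *: _.
have q1le : q1 <= 0.
  by rewrite /q1 /GRing.scale/= invrN mulNr oppr_le0 mulr_ge0 ?invr_ge0 ?(ltW d2)// subr_ge0.
have q2ge : 0 <= q2.
  by rewrite /q2 /GRing.scale/= mulr_ge0 ?invr_ge0 ?(ltW d2)// subr_ge0.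
have [Dp|Dn] := leP 0 D.
  have Dp' : 0 < D by rewrite lt_neqAle eq_sym D0.
  rewrite (ger0_norm Dp) ler_norml => /andP[_ h] _; lra.
move=> _; rewrite (ltr0_norm Dn) ler_norml => /andP[h _]; lra.
Qed.

(* Induction on [j], for all Lipschitz functions at once. Where [W] has slope
   about [r] in the next direction uniformly on a set [E], the induction
   hypothesis applied to the distance to [E], whose gradient vanishes on [E],
   shows that [E] is so thick around almost all its points that the increments
   of [W] in the new direction can be computed from points of [E]. *)
Lemma lipR_partial_frechet (R : realType) n d (T : measurableType d)
    (mu : {measure set T -> \bar R}) (phi : T -> 'rV[R]_n) j :
  lebesgue_like mu phi -> (j <= n)%N -> forall (K : R) (W : 'rV[R]_n -> R),
  lipR K W -> mu.-negligible [set t | ~ partial_frechet j W (phi t)].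
Proof.
move=> ll; elim: j => [_ K W WK|j IH jn K W WK].
  apply: negligibleS (negligible_set0 mu) => t /=; apply => e e0; exists 1 => // h h0 _.
  have -> : h = 0 by apply/rowP => i; rewrite h0// mxE.
  by rewrite addr0 subrr normr0 mulr0 sub0r normrN /dot mul0mx mxE normr0.
pose i0 := Ordinal jn; pose v : 'rV[R]_n := delta_mx ord0 i0.
pose E (p : rat * nat * nat) := slope_set W v (ratr p.1.1) p.1.2.+1%:R^-1 p.2.+1%:R^-1.
(* The slope parameters are rational and integer, so there are countably many sets [E p], and the
   exceptional points of all their distance functions form one null set. *)
pose good p t := partial_frechet j (setdist (E p)) (phi t) /\
  forall i, derivable (setdist (E p)) (phi t) (delta_mx ord0 i).
pose bad k : set T := if unpickle k is Some p then
  [set t | E p !=set0 /\ ~ good p t] else set0.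
have nbad : mu.-negligible (\bigcup_k bad k).
  apply: negligible_bigcup => k; rewrite /bad; case: unpickle => [p|]; last exact: negligible_set0.
  have [E0|E0] := pselect (E p !=set0); last first.
    by apply: negligibleS (negligible_set0 mu) => t [].
  have nd : mu.-negligible (\big[setU/set0]_(i <- enum 'I_n)
      [set t | ~ derivable (setdist (E p)) (phi t) (delta_mx ord0 i)]).
    elim/big_ind: _ => [|A B|i _]; [exact: negligible_set0|exact: negligibleU|].
    exact: lebesgue_like_nonderivable ll (setdist_lipR E0).
  apply: negligibleS (negligibleU (IH (ltnW jn) _ _ (setdist_lipR E0)) nd).
  move=> t [_] /= ngood; apply: contrapT => /not_orP[/contrapT g1 g2].
  apply: ngood; split => // i; apply: contrapT => ndi; apply: g2.
  by rewrite -bigcup_seq; exists i => //=; rewrite mem_enum.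
apply: negligibleS (negligibleU (negligibleU nbad (IH (ltnW jn) _ _ WK))
  (lebesgue_like_nonderivable i0 ll WK)) => t /= nW.
apply: contrapT => /not_orP[/not_orP[tbad /contrapT tj] /contrapT tv].
apply: nW; set x := phi t in tbad tj tv *.
(* The distance to [E p] is minimal at [x], so its gradient vanishes there: points of [E p] lie
   within o(|h|) of [x + h]. *)
have Edist p : E p x -> forall e, 0 < e -> exists2 d, 0 < d &
    forall h : 'rV[R]_n, (forall i : 'I_n, (j <= i)%N -> h ord0 i = 0) ->
    `|h| <= d -> setdist (E p) (x + h) <= e * `|h|.
  move=> Ex; have E0 : E p !=set0 by exists x.
  have [h1 h2] : partial_frechet j (setdist (E p)) x /\
      forall i, derivable (setdist (E p)) x (delta_mx ord0 i).
    apply: contrapT => ng; apply: tbad; exists (pickle p); first exact: I.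
    by rewrite /bad pickleK; split.
  move=> e /h1[dd dd0 H]; exists dd => // h hj hd; have := H h hj hd.
  have -> : gradient (setdist (E p)) x = 0.
    apply/rowP => i; rewrite mxE [RHS]mxE.
    by apply: (@min_derive0 _ _ _ _ _ (h2 i)) => y; rewrite (setdist0 Ex) setdist_ge0.
  rewrite dotE big1 => [|i _]; last by rewrite mxE mulr0.
  rewrite subr0 (setdist0 Ex) subr0.
  by rewrite ger0_norm ?setdist_ge0.
move=> e e0.
(* The final error, in units of [z * |h|]: two moves between [x + h'] and [y], each costing
   [2 * |K|], plus one for the slope on [E], one for the induction hypothesis and one for replacing
   the rational slope by the derivative. *)
have C0 : 0 < 4 * `|K| + 3 by rewrite ltr_wpDl// mulr_ge0.
have [m me] : exists m : nat, m.+1%:R^-1 * (4 * `|K| + 3) < e.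
  exists (Num.truncn ((4 * `|K| + 3) / e)).
  by rewrite ltr_pdivrMl// -ltr_pdivrMr// truncnS_gt.
set z := m.+1%:R^-1 in me.
have z0 : 0 < z by rewrite invr_gt0.
have [q [k Hqk]] := derivable_slope_set z0 tv.
have k0 : 0 < k.+1%:R^-1 :> R by rewrite invr_gt0.
have qE := slope_set_derive k0 Hqk tv.
have [d1 d10 H1] := Edist (q, m, k) Hqk _ z0.
have [d2 d20 H2] := tj _ z0.
exists (Num.min (Num.min d1 d2) k.+1%:R^-1).
  by rewrite !lt_min d10 d20/=.
move=> h hj; rewrite !le_min => /andP[/andP[hd1 hd2] hk].
pose u := h ord0 i0; pose h' := h - u *: v.
have hE : h = h' + u *: v by rewrite subrK.
have th : `|u| <= `|h| by exact: rV_norm_ge.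
have h'h : `|h'| <= `|h|.
  apply: rV_norm_le => // i; rewrite !mxE eqxx/=.
  have [->|ne] := eqVneq i i0; first by rewrite mulr1 subrr normr0.
  by rewrite mulr0 subr0 rV_norm_ge.
have h'j (i : 'I_n) : (j <= i)%N -> h' ord0 i = 0.
  rewrite leq_eqVlt => /orP[/eqP ji|ji].
    have -> : i = i0 by exact: val_inj.
    by rewrite !mxE !eqxx mulr1 subrr.
  rewrite !mxE hj// eqxx/= (_ : (i == i0) = false) ?mulr0 ?subrr//.
  by apply/eqP => ii; move: ji; rewrite ii ltnn.
have [->|hn0] := eqVneq h 0.
  by rewrite addr0 subrr normr0 mulr0 sub0r normrN /dot mul0mx mxE normr0.
have hp : 0 < `|h| by rewrite normr_gt0.
(* The factor 2 provides the strict inequality needed to pick a point from an infimum; this is where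
   [h != 0] serves. *)
have [y Ey xy] : exists2 y, E (q, m, k) y & `|(x + h') - y| < 2 * z * `|h|.
  apply: setdist_lt; first by exists x.
  apply: le_lt_trans (H1 h' h'j (le_trans h'h hd1)) _.
  apply: (@le_lt_trans _ _ (z * `|h|)); first by rewrite ler_wpM2l// ltW.
  by rewrite -mulrA ltr_pMl ?mulr_gt0// ltrDl.
(* The increment is cut along [x], [x + h'], [y], [y + u *: v], [x + h' + u *: v]: the slope in
   direction [v] is controlled at [y], not at [x + h']. *)
have /= K1 := WK (x + h' + u *: v) (y + u *: v).
rewrite opprD addrACA subrr addr0 in K1.
have K2 := WK (x + h') y.
have K3 := Ey u (le_trans th hk).
have K4 := H2 h' h'j (le_trans h'h hd2).
have dh : dot h (gradient W x) = dot h' (gradient W x) + u * 'D_v W x.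
  by rewrite hE dotDl dotZl dot_deltal mxE.
rewrite {1}hE addrA dh.
have Kxy : K * `|x + h' - y| <= `|K| * (2 * z * `|h|).
  apply: (@le_trans _ _ (`|K| * `|x + h' - y|)); first by rewrite ler_wpM2r// ler_norm.
  by rewrite ler_wpM2l// ltW.
have K5 : `|('D_v W x - ratr q) * u| <= z * `|h|.
  by rewrite normrM ler_pM.
have K6 : z * `|h'| <= z * `|h| by rewrite ler_wpM2l// ltW.
have K7 : z * `|u| <= z * `|h| by rewrite ler_wpM2l// ltW.
apply: (@le_trans _ _ ((z * (4 * `|K| + 3)) * `|h|)); last by rewrite ler_wpM2r// ltW.
have {}K1 := le_trans K1 Kxy; have {}K2 := le_trans K2 Kxy.
have {}K3 := le_trans K3 K7; have {}K4 := le_trans K4 K6.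
move: K1 K2 K3 K4 K5 => /=.
rewrite !ler_norml => /andP[a1 b1] /andP[a2 b2] /andP[a3 b3] /andP[a4 b4] /andP[a5 b5].
by apply/andP; split; lra.
Qed.

Lemma dotBl (R : realType) n (u v w : 'rV[R]_n) :
  dot (u - v) w = dot u w - dot v w.
Proof. by rewrite /dot mulmxBl !mxE. Qed.

Lemma dot_norm_le (R : realType) n (u v : 'rV[R]_n) :
  `|dot u v| <= n%:R * `|u| * `|v|.
Proof.
rewrite dotE (le_trans (ler_norm_sum _ _ _))//.
apply: (@le_trans _ _ (\sum_(i < n) `|u| * `|v|)).
  by apply: ler_sum => i _; rewrite normrM ler_pM// rV_norm_ge.
by rewrite sumr_const card_ord -[leLHS]mulr_natl mulrA.
Qed.

Lemma partial_frechet_differentiable (R : realType) n (W : 'rV[R]_n -> R)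
    (x : 'rV[R]_n) : partial_frechet n W x -> differentiable W x.
Proof.
move=> H; pose g := gradient W x.
have lin : linear (fun h : 'rV[R]_n => dot h g : R^o).
  by move=> a u v; rewrite dotDl dotZl.
pose df : {linear 'rV[R]_n -> R^o} := HB.pack (fun h : 'rV[R]_n => dot h g : R^o)
  (GRing.isLinear.Build R 'rV[R]_n R^o _ _ lin).
have cdf : continuous df.
  apply: (@lipR_continuous _ _ (n%:R * `|g|)) => u v.
  rewrite -[df u]/(dot u g) -[df v]/(dot v g).
  have -> : dot u g - dot v g = dot (u - v) g.
    by rewrite dotBl.
  by rewrite (le_trans (dot_norm_le _ _))// mulrAC.
pose f : 'rV[R]_n -> R^o := W.
have E : f \o shift x = cst (f x) + df +o_ (0 : 'rV[R]_n) id.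
  apply/(@eqaddoP R _ R^o 'rV[R]_n) => e e0; have [d d0 Hd] := H _ e0.
  near=> h; rewrite !fctE /= [h + x]addrC opprD addrA.
  apply: Hd; first by move=> i; rewrite leqNgt ltn_ord.
  by near: h; exact: (@nbhs0_le _ 'rV[R]_n).
suff : differentiable f x by [].
apply/diff_locallyP; rewrite (diff_unique cdf E).
by split.
Unshelve. all: by end_near. Qed.

Lemma differentiable_derive (R : realType) n (W : 'rV[R]_n -> R)
    (x v : 'rV[R]_n) : differentiable W x ->
  derivable W x v /\ 'D_v W x = dot v (gradient W x).
Proof.
move=> dW; split; first exact: diff_derivable.
rewrite dotE deriveE// [in LHS](row_sum_delta v) linear_sum.
by apply: eq_bigr => i _; rewrite linearZ mxE deriveE.
Qed.

(** * Mean value inequality *)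

Lemma product_null_ysection (R : realType) d1 d2 (T1 : measurableType d1)
    (T2 : measurableType d2) (m1 : {sigma_finite_measure set T1 -> \bar R})
    (m2 : {sigma_finite_measure set T2 -> \bar R}) (A : set (T1 * T2)) :
  measurable A -> (m1 \x m2)%E A = 0%E ->
  m2.-negligible [set z | m1 (ysection A z) <> 0%E].
Proof.
move=> mA A0.
have A0' : (m1 \x^ m2)%E A = 0%E.
  rewrite -A0; apply/esym/product_measure_unique => // B C mB mC.
  exact: product_measure2E.
have mf := measurable_fun_ysection m1 mA.
have : (\int[m2]_z `|(m1 \o ysection A) z|)%E = 0%E.
  by rewrite -[RHS]A0'; apply: eq_integral => z _ /=; rewrite gee0_abs.
move/(ae_eq_integral_abs m2 measurableT mf).
by apply: negligibleS => z /= + H; apply; exact: H.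
Qed.

(** The segment from [x] is replaced by a parallel one at distance less than [r] that meets the
    non-differentiability set in a null set; this costs [|K| * r] at each end, and [r] is
    arbitrary. *)
Lemma lipR_slope_le_axis (R : realType) n (K : R) (W : 'rV[R]_n.+1 -> R)
    (x : 'rV[R]_n.+1) (m s d : R) : lipR K W -> 0 <= s -> s < d ->
  (forall y, `|y - x| < d -> differentiable W y ->
     'D_(delta_mx ord0 ord0) W y <= m) ->
  W (x + s *: delta_mx ord0 ord0) - W x <= m * s.
Proof.
move=> WK s0 sd Wm; set e := delta_mx ord0 ord0.
have [d' [T [mu [phi ll]]]] := lebesgue_like_exists R n.
have ll' := lebesgue_like_cons ll.
have [A [mA A0 Abad]] := lipR_partial_frechet ll' (leqnn _) WK.
have [N [mN N0 Nbad]] := product_null_ysection mA A0.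
pose u : 'rV[R]_n := \row_i x ord0 (lift ord0 i).
have ux : x = rV_cons (x ord0 ord0) u by exact: rV_cons_eta.
suff H (r : R) : 0 < r -> s + r < d ->
    W (x + s *: e) - W x <= m * s + (`|K| * r) *+ 2.
  apply/ler_addgt0Pl => z z0.
  (* The first term keeps the shifted segment within distance [d] of [x], the second absorbs the
     error of the shift into [z]. *)
  pose r := Num.min ((d - s) / 2) (z / (`|K| *+ 2 + 1)).
  have K1 : 0 < `|K| *+ 2 + 1 by rewrite ltr_wpDl// mulrn_wge0.
  have r0 : 0 < r by rewrite lt_min !divr_gt0// subr_gt0.
  have r1 : r <= (d - s) / 2 by rewrite ge_min lexx.
  have r2 : r <= z / (`|K| *+ 2 + 1) by rewrite ge_min lexx orbT.
  have {}r2 : r * (`|K| *+ 2 + 1) <= z by rewrite -ler_pdivlMr.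
  have := H r r0 ltac:(lra) => h; apply: (le_trans h).
  rewrite addrC lerD2r; apply: le_trans r2.
  by rewrite mulrDr mulr1 -mulrnAl mulrC lerDl ltW.
move=> r0 srd.
(* Every ball has positive measure, so it is not contained in the null set of bad lines. *)
have [z [zu zN]] : exists z, ball u r (phi z) /\ ~ N z.
  apply: contrapT => /forallNP H.
  have [mphi muball _] := ll.
  have : (0 < mu (phi @^-1` ball u r))%E by exact: muball.
  rewrite ltNge => /negP; apply; rewrite -N0; apply: le_measure; rewrite ?inE//.
    by apply: measurable_preimage_borel => //; apply: borel_open; exact: ball_open.
  by move=> z /= zu; have /not_andP[|/contrapT] := H z.
have zA : lebesgue_measure (ysection A z) = 0%E.
  by apply: contrapT => h; apply: zN; exact: Nbad.
pose y (t : R) := rV_cons t (phi z).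
have yE t : y t = rV_cons 0 (phi z) + t *: e.
  by rewrite /y -rV_cons_delta0 rV_consD add0r addr0.
pose a := x ord0 ord0.
have en : `|e| = 1.
  apply/eqP; rewrite eq_le rV_norm_le//=; last first.
    by move=> i; rewrite mxE eqxx/=; case: eqP; rewrite ?normr1 ?normr0.
  by have := rV_norm_ge e ord0; rewrite mxE !eqxx normr1.
have yx t : `|y t - (x + (t - a) *: e)| < r.
  have -> : x + (t - a) *: e = rV_cons t u.
    by rewrite {1}ux -rV_cons_delta0 rV_consD addr0 addrC subrK.
  have -> : y t - rV_cons t u = rV_cons 0 (phi z - u).
    by apply/eqP; rewrite subr_eq rV_consD add0r subrK.
  apply: (@le_lt_trans _ _ `|phi z - u|); last first.
    by move: zu; rewrite -ball_normE /= distrC.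
  apply: rV_norm_le => // i; case: (unliftP ord0 i) => [k|] ->.
    by rewrite rV_consS rV_norm_ge.
  by rewrite rV_cons0 normr0.
pose g (t : R) := W (rV_cons 0 (phi z) + t *: e).
have gs : g (a + s) - g a <= m * (a + s - a).
  apply: (lipschitz_slope_le (lipR_line _ e WK)); first by rewrite lerDl.
  exists (ysection A z); split; [exact: measurable_ysection|exact: zA|].
  move=> t [/andP[a_t tas] dg mg]; rewrite /ysection /= inE.
  apply: contrapT => tzA.
  have /partial_frechet_differentiable dW : partial_frechet n.+1 W (y t).
    by apply: contrapT => h; apply: tzA; exact: Abad.
  have [fwd _] := derivable_line W (rV_cons 0 (phi z)) e t ('D_1 g t).
  have [_ DE] := fwd ltac:(by split).
  move: mg; rewrite ltNge => /negP; apply; rewrite -/g -DE -yE.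
  apply: Wm dW; apply: le_lt_trans srd.
  have -> : y t - x = (y t - (x + (t - a) *: e)) + (t - a) *: e.
    by rewrite opprD addrA subrK.
  apply: le_trans (ler_normD _ _) _; rewrite addrC lerD ?ltW//.
  rewrite normrZ en mulr1 ger0_norm ?subr_ge0 ?ltW//.
  by rewrite ltrBlDl.
have g1 : `|W (x + s *: e) - g (a + s)| <= `|K| * r.
  have := yx (a + s); rewrite (_ : a + s - a = s); last by rewrite addrC addKr.
  move=> /ltW yr; rewrite /g -yE distrC (le_trans (WK _ _))//.
  by rewrite (@le_trans _ _ (`|K| * `|y (a + s) - (x + s *: e)|))// ?ler_wpM2r ?ler_wpM2l ?ler_norm.
have g0 : `|W x - g a| <= `|K| * r.
  have := yx a; rewrite subrr scale0r addr0 => /ltW yr.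
  rewrite /g -yE distrC (le_trans (WK _ _))//.
  by rewrite (@le_trans _ _ (`|K| * `|y a - x|))// ?ler_wpM2r ?ler_wpM2l ?ler_norm.
have as_ : a + s - a = s by rewrite addrC addKr.
rewrite as_ in gs; move: g1 g0; rewrite !ler_norml mulr2n => /andP[_ h1] /andP[h2 _].
lra.
Qed.

(** In the rank factorisation of the single row [v], the column factor is a nonzero scalar and the
    row factor is invertible. *)
Lemma unitmx_first_row (F : fieldType) n (v : 'rV[F]_n.+1) : v != 0 ->
  exists2 M : 'M[F]_n.+1, M \in unitmx & delta_mx ord0 ord0 *m M = v.
Proof.
move=> v0; have rv : \rank v = 1%N by rewrite rank_rV v0.
pose c := col_ebase v ord0 ord0.
have cE : col_ebase v = c%:M by rewrite [LHS]mx11_scalar.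
have c0 : c != 0.
  have := col_ebase_unit v; rewrite unitmxE det_mx11 unitfE; exact.
exists (c *: row_ebase v).
  rewrite unitmxE detZ unitrM unitrX ?unitfE//=.
  by have := row_ebase_unit v; rewrite unitmxE unitfE.
rewrite -[RHS]mulmx_ebase rv cE mul_scalar_mx -scalemxAr -scalemxAl.
congr (_ *: (_ *m _)); apply/rowP => i; rewrite !mxE eqxx/=.
by rewrite andbT -val_eqE eq_sym.
Qed.

Lemma mulmx_norm_le (R : realType) m n (M : 'M[R]_(m, n)) :
  exists2 C, 0 < C & forall u : 'rV[R]_m, `|u *m M| <= C * `|u|.
Proof.
exists (m%:R * `|M| + 1) => [|u]; first by rewrite ltr_wpDl// mulr_ge0.
have C0 : 0 <= m%:R * `|M| by rewrite mulr_ge0.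
apply: (@le_trans _ _ (m%:R * `|M| * `|u|)); last first.
  by rewrite ler_wpM2r// lerDl.
apply: rV_norm_le => [|i]; first by rewrite mulr_ge0.
rewrite mxE (le_trans (ler_norm_sum _ _ _))//.
apply: (@le_trans _ _ (\sum_(i < m) `|M| * `|u|)).
  apply: ler_sum => j _; rewrite normrM mulrC ler_pM ?rV_norm_ge//.
  by rewrite [leRHS]/Num.norm/= mx_normrE (le_bigmax _ _ (j, i)).
by rewrite sumr_const card_ord -[leLHS]mulr_natl mulrA.
Qed.

Lemma mulmx_differentiable (R : realType) m n (M : 'M[R]_(m, n)) (x : 'rV[R]_m) :
  differentiable (fun u : 'rV[R]_m => u *m M) x.
Proof.
have [C C0 HC] := mulmx_norm_le M.
apply: (@linear_differentiable _ _ _ (mulmxr M : {linear 'rV[R]_m -> 'rV[R]_n})).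
move=> u; apply/(@cvgrPdist_le _ _ _ _ (nbhs_filter u)) => e e0; near=> w.
rewrite /= -mulmxBl (le_trans (HC _))// mulrC -ler_pdivlMr//.
by near: w; apply: cvgr_dist_le => //; exact: divr_gt0.
Unshelve. all: by end_near. Qed.

(** A linear change of variables carries the first axis to [v]. Only directional derivatives are
    compared, so invertibility of the matrix is enough. *)
Lemma lipR_slope_le (R : realType) n (K : R) (V : 'rV[R]_n -> R)
    (x v : 'rV[R]_n) (m d : R) : lipR K V -> v != 0 -> 0 < d ->
  (forall y, `|y - x| < d -> differentiable V y -> dot v (gradient V y) <= m) ->
  exists2 s0, 0 < s0 & forall s, 0 <= s -> s < s0 ->
    V (x + s *: v) - V x <= m * s.
Proof.
case: n V x v => [V x v|n V x v] VK v0 d0 Vm.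
  by move: v0; rewrite (thinmx0 v) eqxx.
have [M uM Mv] := unitmx_first_row v0.
have [C C0 MC] := mulmx_norm_le M.
pose W (z : 'rV[R]_n.+1) := V (z *m M).
have WK : lipR (`|K| * C) W.
  move=> y z; apply: le_trans (VK _ _) _; rewrite -mulmxBl.
  apply: (@le_trans _ _ (`|K| * `|(y - z) *m M|)); first by rewrite ler_wpM2r// ler_norm.
  by rewrite -mulrA ler_wpM2l.
pose z0 := x *m invmx M.
have z0M : z0 *m M = x by rewrite mulmxKV.
(* [C] bounds the expansion of [M], so the ball of radius [d / C] is sent into that of radius
   [d]. *)
exists (d / C); first exact: divr_gt0.
move=> s s0 sd.
have := @lipR_slope_le_axis _ _ _ _ z0 m s (d / C) WK s0 sd.
rewrite /W mulmxDl -scalemxAl Mv z0M; apply => z zd dW.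
have dV : differentiable V (z *m M).
  have -> : V = W \o (fun u : 'rV[R]_n.+1 => u *m invmx M).
    by apply/funext => u; rewrite /W/= mulmxKV.
  apply: differentiable_comp; first exact: mulmx_differentiable. 
   by rewrite mulmxK.
have E : (fun h : R => h^-1 *: ((W \o shift z) (h *: delta_mx ord0 ord0) - W z)) =
    (fun h : R => h^-1 *: ((V \o shift (z *m M)) (h *: v) - V (z *m M))).
  by apply/funext => h /=; rewrite /W mulmxDl -scalemxAl Mv.
rewrite /derive E.
have [_] := differentiable_derive v dV; rewrite /derive => ->; apply: Vm => //.
rewrite -z0M -mulmxBl (le_lt_trans (MC _))//.
by rewrite mulrC -ltr_pdivlMr.
Qed.

(** * Clarke gradients *)

Lemma norm_le_qnorm (R : realType) n (q : \bar R) (x : 'rV[R]_n) :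
  (1 <= q)%E -> `|x| <= qnorm q x.
Proof.
case: q => [r||]//=; last first.
  move=> _; apply: rV_norm_le; first exact: bigmax_ge_id.
  by move=> i; exact: (le_bigmax _ (fun i => `|x ord0 i|)).
rewrite lee_fin => r1; have r0 : 0 < r by exact: lt_le_trans r1.
have ri : 0 <= r^-1 by rewrite invr_ge0 ltW.
apply: rV_norm_le => [|i]; first exact: powR_ge0.
have -> : `|x ord0 i| = (`|x ord0 i| `^ r) `^ r^-1.
  by rewrite -powRrM divff ?powRr1// gt_eqF.
apply: ge0_ler_powR; rewrite ?nnegrE ?powR_ge0//.
  by apply: sumr_ge0 => j _; exact: powR_ge0.
by rewrite (bigD1 i)//= lerDl sumr_ge0// => j _; exact: powR_ge0.
Qed.

Lemma qnorm_le_norm (R : realType) n (q : \bar R) :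
  (1 <= q)%E -> exists2 C, 0 < C & forall x : 'rV[R]_n, qnorm q x <= C * `|x|.
Proof.
case: q => [r||]//=; last first.
  move=> _; exists 1 => // x; rewrite mul1r; apply/bigmax_leP; split => // i _.
  exact: rV_norm_ge.
rewrite lee_fin => r1; have r0 : 0 < r by exact: lt_le_trans r1.
have ri : 0 <= r^-1 by rewrite invr_ge0 ltW.
exists (n%:R `^ r^-1 + 1) => [|x]; first by rewrite ltr_wpDl// powR_ge0.
apply: (@le_trans _ _ (n%:R `^ r^-1 * `|x|)); last by rewrite ler_wpM2r// lerDl.
have -> : `|x| = (`|x| `^ r) `^ r^-1.
  by rewrite -powRrM divff ?powRr1// gt_eqF.
rewrite -powRM ?powR_ge0//.
apply: ge0_ler_powR; rewrite ?nnegrE ?mulr_ge0 ?powR_ge0//.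
  by apply: sumr_ge0 => j _; exact: powR_ge0.
rewrite mulr_natl -[X in _ *+ X]card_ord -sumr_const; apply: ler_sum => i _.
by apply: ge0_ler_powR; rewrite ?nnegrE ?rV_norm_ge// ltW.
Qed.

Lemma lipschitz_fun_lipR (R : realType) n (q : \bar R) (V : 'rV[R]_n -> R) :
  (1 <= q)%E -> lipschitz_fun q V -> exists2 K, 0 <= K & lipR K V.
Proof.
move=> q1 [K VK]; have [C C0 HC] := qnorm_le_norm n q1.
exists (`|K| * C) => [|x y]; first by rewrite mulr_ge0// ltW.
apply: le_trans (VK _ _) _; rewrite -mulrA.
apply: (@le_trans _ _ (`|K| * qnorm q (x - y))).
  by rewrite ler_wpM2r ?ler_norm// (le_trans _ (norm_le_qnorm _ q1)).
by rewrite ler_wpM2l.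
Qed.

Lemma lipR_gradient_le (R : realType) n (K : R) (V : 'rV[R]_n -> R) x :
  0 <= K -> lipR K V -> differentiable V x -> `|gradient V x| <= K.
Proof.
move=> K0 VK dV; apply: rV_norm_le => // i; rewrite mxE.
have [d1 _] := differentiable_derive (delta_mx ord0 i) dV.
have en : `|delta_mx ord0 i : 'rV[R]_n| <= 1.
  by apply: rV_norm_le => // j; rewrite mxE eqxx/=; case: eqP; rewrite ?normr1 ?normr0.
(* The Lipschitz bound is read as membership in a slope set with slope 0 and tolerance [K]. *)
rewrite -[leLHS]/(`|_|) -[X in `|X|]subr0.
apply: (@slope_set_derive _ _ V (delta_mx ord0 i) x 0 K 1) => // s _.
rewrite mul0r subr0 (le_trans (VK _ _))// ler_wpM2l// addrC addKr normrZ.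
by rewrite ler_piMr.
Qed.

(** Upper semicontinuity of the Clarke gradient: otherwise gradients at points tending to [x],
    bounded by [K], cluster at a [g] that belongs to the Clarke gradient at [x] and has
    [dot v g >= m']. *)
Lemma clarke_gradient_slope (R : realType) n (q : \bar R) (K : R)
    (V : 'rV[R]_n -> R) (x v : 'rV[R]_n) (m m' : R) :
  (1 <= q)%E -> 0 <= K -> lipR K V -> m < m' ->
  (forall g, clarke_gradient q V x g -> dot v g <= m) ->
  exists2 d, 0 < d & forall y, `|y - x| < d -> differentiable V y ->
    dot v (gradient V y) <= m'.
Proof.
move=> q1 K0 VK mm Hg; apply: contrapT => H.
have /choice[y Hy] : forall k : nat, exists y, [/\ `|y - x| < k.+1%:R^-1,
    differentiable V y & m' < dot v (gradient V y)].
  move=> k; apply: contrapT => Hk; apply: H; exists k.+1%:R^-1; first by rewrite invr_gt0.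
  move=> y yx dV; rewrite leNgt; apply/negP => h; apply: Hk; by exists y.
have [C C0 HC] := qnorm_le_norm n q1.
pose B := [set g : 'rV[R]_n | `|g| <= K].
have cB : compact B.
  apply: bounded_closed_compact.
    by exists K; split; [exact: num_real|move=> M KM g /= gK; rewrite (le_trans gK)// ltW].
  by apply: closed_sublevel => g; exact: norm_continuous.
have [|g [_ clg]] := cB (gradient V (y k) @[k --> \oo]) _ _.
  by exists 0%N => // k _ /=; have [_ dV _] := Hy k; exact: lipR_gradient_le.
have near_g e : 0 < e -> exists k, k.+1%:R^-1 < e /\ `|g - gradient V (y k)| < e.
  move=> e0; pose N := Num.truncn e^-1.
  have [||z [[k Nk <-] gz]] := clg [set gradient V (y k) | k in [set k | (N <= k)%N]] (ball g e).
  - by exists N => // k /= Nk; exists k.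
  - exact: nbhsx_ballx.
  exists k; split; last by move: gz; rewrite -ball_normE.
  rewrite invf_plt ?posrE//; apply: lt_le_trans (truncnS_gt _) _.
  by rewrite ler_nat ltnS.
have : m' <= dot v g.
  apply/ler_addgt0Pl => e e0.
  have D0 : 0 < n%:R * `|v| + 1 by rewrite ltr_wpDl// mulr_ge0.
  have [k [_ gk]] := near_g _ (divr_gt0 e0 D0).
  have [_ _ /ltW mk] := Hy k; apply: (le_trans mk).
  rewrite -lerBlDr; apply: le_trans (ler_norm _) _.
  have -> : dot v (gradient V (y k)) - dot v g = - dot v (g - gradient V (y k)).
    by rewrite /dot linearB/= mulmxBr !mxE opprB.
  rewrite normrN (le_trans (dot_norm_le _ _))//.
  apply: (@le_trans _ _ ((n%:R * `|v| + 1) * `|g - gradient V (y k)|)).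
    by rewrite ler_wpM2r// lerDl.
  by rewrite mulrC -ler_pdivlMr// ltW.
apply/negP; rewrite -ltNge; apply: le_lt_trans mm; apply: Hg.
apply: sub_gen_smallest => e e0.
have [k [ke gk]] := near_g _ (divr_gt0 e0 C0).
have [yx dV _] := Hy k; exists (y k); split => //.
  rewrite (le_lt_trans (HC _))// mulrC -ltr_pdivlMr// distrC.
  exact: lt_trans ke.
by rewrite (le_lt_trans (HC _))// mulrC -ltr_pdivlMr.
Qed.

(** * Ordinary differential equations *)

Lemma cvg_rV (R : realType) n (T : Type) (F : set_system T) (f : T -> 'rV[R]_n)
    (l : 'rV[R]_n) : Filter F ->
  f x @[x --> F] --> l <-> forall i, f x ord0 i @[x --> F] --> l ord0 i.
Proof.
move=> FF; split=> [fl i|fl].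
  apply/cvgrPdist_le => e e0; have /cvgrPdist_le/(_ _ e0) := fl.
  apply: filterS => x; apply: le_trans.
  by have := rV_norm_ge (l - f x) i; rewrite !mxE.
apply/cvgrPdist_le => e e0.
have : \forall x \near F, forall i, `|l ord0 i - f x ord0 i| <= e.
  by apply: filter_forall => i; have /cvgrPdist_le := fl i; exact.
apply: filterS => x H; apply: rV_norm_le; first exact: ltW.
by move=> i; rewrite !mxE.
Qed.

Lemma is_deriveP (R : realType) (V : normedModType R) (x : R -> V) (t : R) (v : V) :
  is_derive t 1 x v <-> h^-1 *: (x (h + t) - x t) @[h --> 0^'] --> v.
Proof.
have E : (fun h : R => h^-1 *: ((x \o shift t) (h *: (1 : R)) - x t)) =
    (fun h => h^-1 *: (x (h + t) - x t)).
  by apply/funext => h /=; rewrite [h%:A]mulr1.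
split=> [[dx <-]|H]; first by rewrite -E; exact: dx.
split; first by apply/cvg_ex; exists v; rewrite E.
by rewrite /derive E; exact: cvg_lim.
Qed.

Lemma is_derive_rV (R : realType) n (x : R -> 'rV[R]_n) (t : R) (v : 'rV[R]_n) :
  is_derive t 1 x v <->
  forall i, is_derive t 1 (fun s => x s ord0 i) (v ord0 i).
Proof.
have E i : (fun h : R => (h^-1 *: (x (h + t) - x t)) ord0 i) =
    (fun h : R => h^-1 *: (x (h + t) ord0 i - x t ord0 i)).
  by apply/funext => h; rewrite !mxE.
split=> [/is_deriveP/cvg_rV H i|H]; apply/is_deriveP.
  by rewrite -E.
by apply/cvg_rV => i; rewrite E; exact/is_deriveP.
Qed.

(* In the norm [sup_t `|phi t| / expR (a * t)] the Picard operator is a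
   contraction once [a] exceeds the Lipschitz constant of the field. *)
Lemma gronwall_iteration (R : realType) (phi dphi : R -> R) (T a c : R) :
  0 < a -> 0 <= c -> phi 0 = 0 -> {within `[0, T], continuous phi} ->
  (forall s, 0 < s < T -> is_derive s 1 phi (dphi s)) ->
  (forall s, 0 < s < T -> `|dphi s| <= c * expR (a * s)) ->
  forall t, 0 <= t <= T -> `|phi t| <= c / a * expR (a * t).
Proof.
move=> a0 c0; have ca0 : 0 <= c / a by rewrite divr_ge0// ltW.
(* A one-sided bound, used for both [phi] and [- phi]: the gap [psi] starts at [c / a] and has
   nonnegative derivative. *)
have aux (u du : R -> R) : u 0 = 0 -> {within `[0, T], continuous u} ->
    (forall s, 0 < s < T -> is_derive s 1 u (du s)) ->
    (forall s, 0 < s < T -> du s <= c * expR (a * s)) ->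
    forall t, 0 <= t <= T -> u t <= c / a * expR (a * t).
  move=> u0 cu Du duc t /andP[]; rewrite le_eqVlt => /predU1P[<-|t0] tT.
    by rewrite u0 mulr_ge0// expR_ge0.
  pose psi (s : R) := c / a * expR (a * s) - u s.
  have Dexp (s : R) : is_derive s 1 (fun s => c / a * expR (a * s)) (c * expR (a * s)).
    apply: is_derive_eq.
    by rewrite /GRing.scale/=; field; rewrite gt_eqF.
  have [||xi] := @MVT R psi (fun s => c * expR (a * s) - du s) 0 t t0.
  - move=> s; rewrite in_itv/= => /andP[s0 st].
    by apply: is_deriveB => //; apply: Du; rewrite s0 (lt_le_trans st).
  - have cu' : {within `[0, t], continuous u}.
      by apply: continuous_subspaceW cu; apply: subset_itvl; rewrite bnd_simp.
    have ce : {within `[0, t], continuous (fun s => c / a * expR (a * s))}.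
      apply: derivable_within_continuous => s _; exact: ex_derive.
    move=> s; apply: (@continuousB R R^o (subspace `[0, t]) (fun s => c / a * expR (a * s)) u s).
      exact: ce.
    exact: cu'.
  rewrite in_itv/= => /andP[x0 xt]; rewrite /psi u0 mulr0 expR0 !subr0 mulr1 => E.
  have : 0 <= (c * expR (a * xi) - du xi) * t.
    by rewrite mulr_ge0 ?(ltW t0)// subr_ge0 duc// x0 (lt_le_trans xt).
  by rewrite -E; lra.
move=> p0 cp Dp Bp t tT; rewrite ler_norml; apply/andP; split; last first.
  apply: (aux phi dphi) => // s sT; apply: le_trans (Bp _ sT); exact: ler_norm.
rewrite lerNl; apply: (aux (- phi) (- dphi)) => //.
- by rewrite !fctE p0 oppr0.
- by move=> s; apply: continuousN; exact: cp.
- by move=> s sT; rewrite !fctE; apply: is_deriveN; exact: Dp.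
- move=> s sT; apply: le_trans (Bp _ sT); rewrite !fctE -normrN; exact: ler_norm.
Qed.

Lemma continuous_antiderivative (R : realType) (g : R -> R) : continuous g ->
  exists G : R -> R, G 0 = 0 /\ forall t : R, -1 < t -> is_derive t 1 G (g t).
Proof.
move=> cg.
(* Integrating from -1 makes the derivative at 0 two-sided. *)
pose I (t : R) := (\int[lebesgue_measure]_(s in [set` Interval (BRight (-1)) (BRight t)]) g s)%R.
exists (fun t => I t - I 0); split => [|t t1]; first by rewrite subrr.
have igt : lebesgue_measure.-integrable `]-1, (t + 1)] (EFin \o g).
  apply: (@integrableS _ _ _ lebesgue_measure `[-1, t + 1]).
  - exact: measurable_itv.
  - exact: measurable_itv.
  - exact: subset_itv_oc_cc.
  apply: continuous_compact_integrable; first exact: segment_compact.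
  by apply: continuous_subspaceT.
have tt : t < t + 1 by rewrite ltrDl.
have [dI DI] := continuous_FTC1 tt igt t1 (cg t).
have isI : is_derive t 1 I (g t) by split => //; rewrite -derive1E.
by apply: is_derive_eq; rewrite subr0.
Qed.

Lemma half_pow_small (R : realType) (C e : R) : 0 < e ->
  exists k : nat, C * 2^-1 ^+ k < e.
Proof.
move=> e0; exists (Num.truncn (`|C| / e)).
set k := Num.truncn _; rewrite exprVn ltr_pdivrMr ?exprn_gt0//.
apply: le_lt_trans (ler_norm C) _.
rewrite mulrC -ltr_pdivrMr//; apply: lt_le_trans (truncnS_gt _) _.
by rewrite -natrX ler_nat ltn_expl.
Qed.

Lemma gronwall_iteration_rV (R : realType) n (phi dphi : R -> 'rV[R]_n)
    (T a c : R) : 0 < a -> 0 <= c -> phi 0 = 0 ->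
  {within `[0, T], continuous phi} ->
  (forall s, 0 < s < T -> is_derive s 1 phi (dphi s)) ->
  (forall s, 0 < s < T -> `|dphi s| <= c * expR (a * s)) ->
  forall t, 0 <= t <= T -> `|phi t| <= c / a * expR (a * t).
Proof.
move=> a0 c0 p0 cp Dp Bp t tT; apply: rV_norm_le => [|i].
  by rewrite mulr_ge0 ?expR_ge0// divr_ge0// ltW.
apply: (@gronwall_iteration _ (fun s => phi s ord0 i) (fun s => dphi s ord0 i) T) => //.
- by rewrite p0 mxE.
- move=> s; exact: (cvg_rV _ _ _).1 (cp s) i.
- by move=> s sT; exact: (is_derive_rV _ _ _).1 (Dp s sT) i.
- by move=> s sT; apply: le_trans (rV_norm_ge _ i) (Bp s sT).
Qed.

Lemma picard_step (R : realType) n (h : 'rV[R]_n -> 'rV[R]_n) (x0 : 'rV[R]_n)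
    (u : R -> 'rV[R]_n) : continuous h -> continuous u ->
  exists w : R -> 'rV[R]_n, [/\ continuous w, w 0 = x0 &
    forall t : R, 0 < t -> is_derive t 1 w (h (u t))].
Proof.
move=> ch cu.
have /choice[G HG] : forall i : 'I_n, exists G : R -> R, G 0 = 0 /\
    forall t : R, -1 < t -> is_derive t 1 G (h (u t) ord0 i).
  move=> i; apply: (@continuous_antiderivative _ (fun t => h (u t) ord0 i)) => t.
  have : h (u s) @[s --> t] --> h (u t).
    by apply: (@continuous_comp _ _ _ u h); [exact: cu|exact: ch].
  by move=> /cvg_rV; exact.
(* Freezing the path at negative times makes it continuous on the whole line, as the iteration
   requires. *)
exists (fun t => x0 + \row_i G i (Num.max t 0)); split.
- move=> t; apply/cvg_rV => i.
  have -> : (fun s : R => (x0 + \row_j G j (Num.max s 0)) ord0 i) =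
      (fun s => x0 ord0 i + G i (Num.max s 0)).
    by apply/funext => s; rewrite !mxE.
  rewrite !mxE; apply: cvgD; first exact: cvg_cst.
  have cm : {for t, continuous (fun s : R => Num.max s 0)}.
    by apply: continuous_max; [move=> A; exact|exact: cst_continuous].
  apply: (@continuous_comp _ _ _ (fun s : R => Num.max s 0) (G i) t cm).
  apply/differentiable_continuous/derivable1_diffP.
  have [_ /(_ (Num.max t 0))] := HG i.
  by case=> //; rewrite lt_max ltrN10 orbT.
- apply/rowP => i; rewrite !mxE maxxx.
  by have [-> _] := HG i; rewrite addr0.
- move=> t t0; apply/is_derive_rV => i.
  have [_ /(_ t)] := HG i; rewrite (lt_trans _ t0) ?ltrN10// => /(_ erefl)[dG DG].
  have E : \near t, x0 ord0 i + G i t = (x0 + \row_j G j (Num.max t 0)) ord0 i.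
    near=> s; rewrite !mxE max_l// ltW//; near: s; exact: lt_nbhsr.
  have [d1 D1] : is_derive t 1 (fun s => x0 ord0 i + G i s) (h (u t) ord0 i).
    have isG : is_derive t 1 (G i) (h (u t) ord0 i) by split.
    by apply: is_derive_eq; rewrite add0r mul1r.
  split; first exact: near_eq_derivable E d1.
  by rewrite -D1; apply/esym/near_eq_derive.
Unshelve. all: by end_near. Qed.

(** Picard iteration with weight [expR (2 * L * t)]: the contraction ratio is L / (2L) = 1/2 on the
    whole half-line, so no gluing of local solutions is needed. *)
Lemma global_solution (R : realType) n (h : 'rV[R]_n -> 'rV[R]_n) (L : R)
    (x0 : 'rV[R]_n) : 0 < L -> (forall x y, `|h x - h y| <= L * `|x - y|) ->
  exists x : R -> 'rV[R]_n, [/\ continuous x, x 0 = x0 &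
    forall t : R, 0 < t -> is_derive t 1 x (h (x t))].
Proof.
move=> L0 hL.
have a0 : 0 < 2 * L by rewrite mulr_gt0.
have ch : continuous h.
  move=> x; apply/(@cvgrPdist_le _ _ _ _ (nbhs_filter x)) => e e0; near=> y.
  apply: le_trans (hL x y) _; rewrite mulrC -ler_pdivlMr//.
  by near: y; apply: cvgr_dist_le => //; exact: divr_gt0.
have /choice[Phi HPhi] : forall u : R -> 'rV[R]_n, exists w : R -> 'rV[R]_n,
    continuous u -> [/\ continuous w, w 0 = x0 &
      forall t : R, 0 < t -> is_derive t 1 w (h (u t))].
  move=> u; have [cu|ncu] := pselect (continuous u); last by exists u.
  by have [w Hw] := picard_step x0 ch cu; exists w.
pose e (t : R) := expR (2 * L * t).
have e_ge0 t : 0 <= e t by exact: expR_ge0.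
have contract (u v : R -> 'rV[R]_n) (c : R) : continuous u -> continuous v ->
    0 <= c -> (forall t, 0 <= t -> `|u t - v t| <= c * e t) ->
    forall t, 0 <= t -> `|Phi u t - Phi v t| <= c / 2 * e t.
  move=> cu cv c0 uv t t0.
  have [cu1 u0 Du] := HPhi u cu; have [cv1 v0 Dv] := HPhi v cv.
  have -> : c / 2 = (c * L) / (2 * L) by field; rewrite gt_eqF.
  apply: (@gronwall_iteration_rV _ _ (fun s => Phi u s - Phi v s)
    (fun s => h (u s) - h (v s)) t) => //.
  - by rewrite mulr_ge0// ltW.
  - by rewrite u0 v0 subrr.
  - apply: continuous_subspaceT => s; apply: (@continuousB R _ R (Phi u) (Phi v)).
      exact: cu1.
    exact: cv1.
  - by move=> s /andP[s0 _]; apply: is_deriveB; [exact: Du|exact: Dv].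
  - move=> s /andP[s0 _]; apply: le_trans (hL _ _) _.
    by rewrite mulrAC [leRHS]mulrC ler_wpM2l ?uv// ltW.
  - by rewrite t0 lexx.
pose u k := iter k Phi (cst x0).
have cont_u k : continuous (u k).
  elim: k => [|k IH]; first by move=> t; exact: cst_continuous.
  by have [] := HPhi _ IH.
(* The weighted size of the first Picard step, whose derivative is the constant [h x0]. *)
pose M := `|h x0| / (2 * L).
have M0 : 0 <= M by rewrite divr_ge0// ltW.
have hp k : 0 <= 2 * M * 2^-1 ^+ k.
  by apply: mulr_ge0; [exact: mulr_ge0|rewrite exprn_ge0 ?invr_ge0].
have u1 t : 0 <= t -> `|u 1%N t - u 0%N t| <= M * e t.
  move=> t0; have [c1 w0 Dw] := HPhi _ (cont_u 0%N).
  apply: (@gronwall_iteration_rV _ _ (fun s => u 1%N s - u 0%N s) (fun s => h x0) t) => //.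
  - by rewrite /= w0 subrr.
  - apply: continuous_subspaceT => s; apply: (@continuousB R _ R (u 1%N) (u 0%N)).
      exact: c1.
    exact: cont_u.
  - move=> s /andP[s0 _]; have := Dw s s0 => D.
    have Dc : is_derive s 1 (u 0%N) 0 by exact: is_derive_cst.
    by have := is_deriveB D Dc; rewrite subr0.
  - move=> s /andP[s0 _]; rewrite ler_peMr// -[leLHS]expR0 ler_expR.
    by apply: mulr_ge0; apply: ltW.
  - by rewrite t0 lexx.
have uS k t : 0 <= t -> `|u k.+1 t - u k t| <= M * 2^-1 ^+ k * e t.
  elim: k t => [|k IH] t t0; first by rewrite expr0 mulr1; exact: u1.
  have Mk : 0 <= M * 2^-1 ^+ k by rewrite mulr_ge0// exprn_ge0// invr_ge0.
  rewrite exprSr mulrA.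
  exact: (contract (u k.+1) (u k) _ (cont_u k.+1) (cont_u k) Mk IH).
(* The subtracted term makes the geometric sum go through by induction on [j]. *)
have ukj k j t : 0 <= t ->
    `|u (k + j)%N t - u k t| <= (2 * M * 2^-1 ^+ k - 2 * M * 2^-1 ^+ (k + j)) * e t.
  move=> t0; elim: j => [|j IH]; first by rewrite addn0 !subrr normr0 mul0r.
  rewrite addnS; apply: le_trans (ler_distD (u (k + j)%N t) _ _) _.
  apply: le_trans (lerD (uS (k + j)%N t t0) IH) _.
  rewrite -mulrDl ler_wpM2r// exprSr.
  set z := 2^-1 ^+ (k + j); lra.
have uk k j t : 0 <= t -> `|u (k + j)%N t - u k t| <= 2 * M * 2^-1 ^+ k * e t.
  move=> t0; apply: le_trans (ukj k j t t0) _; rewrite ler_wpM2r// gerBl.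
  exact: hp.
have cvg_u t : 0 <= t -> cvg (u k t @[k --> \oo]).
  move=> t0; apply/cauchy_cvgP; apply/cauchy_exP => z z0.
  have [k kz] := half_pow_small (2 * M * e t) z0.
  exists (u k t); exists k => // j /= kj; rewrite -ball_normE /= distrC -(subnKC kj).
  by apply: le_lt_trans (uk _ _ _ t0) _; rewrite mulrAC.
have /choice[x Hx] : forall t : R, exists l : 'rV[R]_n, u k (Num.max t 0) @[k --> \oo] --> l.
  move=> t; have t0 : 0 <= Num.max t 0 by rewrite le_max lexx orbT.
  by have /cvg_ex := cvg_u _ t0.
have xu k t : `|x t - u k (Num.max t 0)| <= 2 * M * 2^-1 ^+ k * e (Num.max t 0).
  have t0 : 0 <= Num.max t 0 by rewrite le_max lexx orbT.
  apply/ler_addgt0Pl => z z0.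
  have /cvgrPdist_le/(_ _ z0)[N _ HN] := Hx t.
  have := HN (k + N)%N (leq_addl _ _); move=> /= h1.
  apply: le_trans (ler_distD (u (k + N)%N (Num.max t 0)) _ _) _.
  exact: lerD h1 (uk _ _ _ t0).
have xu0 k t : 0 <= t -> `|x t - u k t| <= 2 * M * 2^-1 ^+ k * e t.
  by move=> t0; have := xu k t; rewrite max_l.
have cx : continuous x.
  move=> t; apply/cvgrPdist_le => z z0.
  have z4 : 0 < z / 4 by rewrite divr_gt0.
  (* The weight is increasing, so its value at [t + 1] gives uniform convergence near [t]. *)
  have [k kz] := half_pow_small (2 * M * e (Num.max (t + 1) 0)) z4.
  have {}kz s : s <= t + 1 -> `|x s - u k (Num.max s 0)| <= z / 4.
    move=> st; apply: le_trans (xu k s) _; apply: le_trans (ltW kz).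
    rewrite mulrAC ler_wpM2r ?exprn_ge0 ?invr_ge0//.
    rewrite (ler_wpM2l (mulr_ge0 _ M0))// /e ler_expR ler_wpM2l ?(ltW a0)//.
    by rewrite ge_max !le_max st lexx /= orbT.
  have cm : {for t, continuous (fun s : R => Num.max s 0)}.
    by apply: continuous_max; [move=> A; exact|exact: cst_continuous].
  have cuk : {for t, continuous (u k \o (fun s : R => Num.max s 0))}.
    by apply: (@continuous_comp _ _ _ (fun s : R => Num.max s 0) (u k) t cm); exact: cont_u.
  have t1 : t < t + 1 by rewrite ltrDl.
  near=> s.
  have h1 : `|u k (Num.max t 0) - u k (Num.max s 0)| <= z / 4.
    by near: s; move/cvgrPdist_le : cuk => /(_ _ z4).
  have h2 : s <= t + 1.
    by apply: ltW; near: s; apply: (lt_nbhsl t1).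
  have h3 : `|x t - u k (Num.max t 0)| <= z / 4 by apply: kz; rewrite lerDl.
  have := kz s h2; rewrite distrC => h4.
  apply: le_trans (ler_distD (u k (Num.max t 0)) _ _) _.
  have := ler_distD (u k (Num.max s 0)) (u k (Num.max t 0)) (x s); lra.
have [cPx Px0 DPx] := HPhi x cx.
have PxE t : 0 <= t -> Phi x t = x t.
  move=> t0; apply/eqP; rewrite -subr_eq0 -normr_le0; apply/ler_addgt0Pl => z z0.
  have [k kz] := half_pow_small (2 * M * e t) z0.
  rewrite addr0; apply: ltW; apply: le_lt_trans kz.
  apply: le_trans (ler_distD (u k.+1 t) _ _) _.
  have Mk := hp k.
  have h1 := contract x (u k) _ cx (cont_u k) Mk (fun s s0 => xu0 k s s0) t t0.
  have h2 := xu0 k.+1 t t0; rewrite distrC exprSr in h2.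
  apply: le_trans (lerD h1 h2) _.
  rewrite -mulrDl [leRHS]mulrAC ler_wpM2r//.
  set y := 2^-1 ^+ k; lra.
(* [Phi x] is the witness because its derivative is already known; it equals [x] at nonnegative
   times. *)
exists (Phi x); split => // t t0.
by rewrite (PxE t (ltW t0)); exact: DPx.
Unshelve. all: by end_near. Qed.

(** The maximum over [0, t] of the weighted distance is at most half of itself, by the same
    contraction. *)
Lemma solution_unique (R : realType) n (h : 'rV[R]_n -> 'rV[R]_n) (L : R)
    (x y : R -> 'rV[R]_n) : 0 < L ->
  (forall x y, `|h x - h y| <= L * `|x - y|) ->
  {within `[0, +oo[, continuous x} -> {within `[0, +oo[, continuous y} ->
  x 0 = y 0 ->
  (forall t : R, 0 < t -> is_derive t 1 x (h (x t))) ->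
  (forall t : R, 0 < t -> is_derive t 1 y (h (y t))) ->
  forall t, 0 <= t -> x t = y t.
Proof.
move=> L0 hL cx cy xy0 Dx Dy t t0.
have a0 : 0 < 2 * L by rewrite mulr_gt0.
have cxy : {within `[0, t], continuous (fun s => x s - y s)}.
  have sub : `[0, t] `<=` (`[0, +oo[ : set R).
    by move=> s /=; rewrite !in_itv/= => /andP[->].
  have cx' := continuous_subspaceW sub cx; have cy' := continuous_subspaceW sub cy.
  move=> s; apply: (@continuousB R _ (subspace `[0, t]) x y); [exact: cx'|exact: cy'].
pose r (s : R) := `|x s - y s| / expR (2 * L * s).
have cr : {within `[0, t], continuous r}.
  have -> : r = (fun s => `|x s - y s| * expR (- (2 * L * s))).
    by apply/funext => s; rewrite /r expRN.
  have ce : {within `[0, t], continuous (fun s => expR (- (2 * L * s)))}.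
    by apply: derivable_within_continuous => s _; exact: ex_derive.
  rewrite continuous_subspace_in => s _.
  apply: cvgM; last exact: ce.
  by apply: cvg_norm; exact: cxy.
have [c ct rc] := EVT_max t0 cr.
have rb s : 0 <= s <= t -> `|x s - y s| <= r c * expR (2 * L * s).
  by move=> st; rewrite -ler_pdivrMr ?expR_gt0//; apply: rc; rewrite in_itv.
have rc0 : 0 <= r c by rewrite divr_ge0// expR_ge0.
have H := @gronwall_iteration_rV _ _ (fun s => x s - y s)
    (fun s => h (x s) - h (y s)) t (2 * L) (L * r c) a0.
have : r c <= r c / 2.
  rewrite [leLHS]/r ler_pdivrMr ?expR_gt0//.
  have -> : r c / 2 = (L * r c) / (2 * L) by field; rewrite gt_eqF.
  apply: H; rewrite ?in_itv//.
  - by rewrite mulr_ge0// ltW.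
  - by rewrite xy0 subrr.
  - by move=> s /andP[s0 _]; apply: is_deriveB; [exact: Dx|exact: Dy].
  - move=> s /andP[s0 st]; apply: le_trans (hL _ _) _.
    by rewrite -mulrA ler_wpM2l ?(ltW L0)// rb// !ltW.
have rc00 : 0 <= r c by [].
move=> rc2; have {rc2} rc1 : r c = 0 by apply/eqP; rewrite eq_le rc00 andbT; lra.
have := rb t; rewrite t0 lexx rc1 mul0r normr_le0 subr_eq0 => /(_ erefl) /eqP; exact.
Qed.

(** * Decrease of V along trajectories *)

(** McShane's extension: an infimum of [L]-Lipschitz functions. *)
Lemma lipschitz_extension_real (R : realType) n (X : set 'rV[R]_n)
    (f : 'rV[R]_n -> R) (L : R) : 0 <= L -> X !=set0 ->
  (forall x y, X x -> X y -> `|f x - f y| <= L * `|x - y|) ->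
  exists h : 'rV[R]_n -> R, lipR L h /\ forall x, X x -> h x = f x.
Proof.
move=> L0 [x0 Xx0] fL.
pose S x := [set f y + L * `|x - y| | y in X].
have Sn x : S x !=set0 by exists (f x0 + L * `|x - x0|), x0.
have Slb x : lbound (S x) (f x0 - L * `|x0 - x|).
  move=> _ [y Xy <-]; have := fL _ _ Xx0 Xy; rewrite ler_norml => /andP[_ h1].
  have := ler_wpM2l L0 (ler_distD x x0 y); lra.
have Shl x : has_lbound (S x) by exists (f x0 - L * `|x0 - x|).
have H x y : inf (S x) <= inf (S y) + L * `|x - y|.
  rewrite -lerBlDr; apply: lb_le_inf => // _ [z Xz <-].
  rewrite lerBlDr; apply: (@le_trans _ _ (f z + L * `|x - z|)).
    by apply: ge_inf => //; exists z.
  by have := ler_wpM2l L0 (ler_distD y x z); lra.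
exists (fun x => inf (S x)); split=> [x y|x Xx].
  rewrite ler_norml; have := H x y; have := H y x; rewrite (distrC y x); lra.
apply/eqP; rewrite eq_le; apply/andP; split.
  by apply: ge_inf => //; exists x => //; rewrite subrr normr0 mulr0 addr0.
apply: lb_le_inf => // _ [y Xy <-].
by have := fL _ _ Xx Xy; rewrite ler_norml => /andP[_]; lra.
Qed.

(** For the sup norm, extending coordinate by coordinate loses nothing in [L]. *)
Lemma lipschitz_extension (R : realType) n k (X : set 'rV[R]_n)
    (f : 'rV[R]_n -> 'rV[R]_k) (L : R) : 0 <= L -> X !=set0 ->
  (forall x y, X x -> X y -> `|f x - f y| <= L * `|x - y|) ->
  exists h : 'rV[R]_n -> 'rV[R]_k,
    (forall x y, `|h x - h y| <= L * `|x - y|) /\ forall x, X x -> h x = f x.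
Proof.
move=> L0 X0 fL.
have /choice[h hP] : forall i : 'I_k, exists h : 'rV[R]_n -> R,
    lipR L h /\ forall x, X x -> h x = f x ord0 i.
  move=> i; apply: lipschitz_extension_real => // x y Xx Xy.
  by have := le_trans (rV_norm_ge _ i) (fL _ _ Xx Xy); rewrite !mxE.
exists (fun x => \row_i h i x); split=> [x y|x Xx].
  apply: rV_norm_le => [|i]; first by rewrite mulr_ge0.
  by rewrite !mxE; have [+ _] := hP i; exact.
by apply/rowP => i; rewrite mxE; have [_ ->] := hP i.
Qed.

(** The infimum of the times of violation still satisfies the bound by continuity, and the step
    pushes past it. The step may use the whole past, which is how a trajectory is known to have
    stayed in [X]. *)
Lemma real_induction (R : realType) (w : R -> R) (b : R) : continuous w ->
  w 0 <= b ->
  (forall t, 0 <= t -> (forall r, 0 <= r <= t -> w r <= b) ->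
    exists2 d, 0 < d & forall s, 0 <= s <= d -> w (t + s) <= b) ->
  forall t, 0 <= t -> w t <= b.
Proof.
move=> cw w0 step t t0; rewrite leNgt; apply/negP => wt.
pose S := [set r | 0 <= r /\ b < w r].
have S0 : S !=set0 by exists t.
have Slb : has_lbound S by exists 0 => r [].
pose tau := inf S.
have tau0 : 0 <= tau by apply: lb_le_inf => // r [].
have below r : 0 <= r -> r < tau -> w r <= b.
  move=> r0 rt; rewrite leNgt; apply/negP => wr.
  by move: rt; rewrite ltNge => /negP; apply; apply: ge_inf.
have at_tau : w tau <= b.
  move: tau0; rewrite le_eqVlt => /predU1P[<-//|tau0].
  apply/ler_addgt0Pl => e e0.
  have : \forall r \near tau, `|w tau - w r| <= e.
    by have /cvgrPdist_le := cw tau; exact.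
  move=> [d /= d0 Hd].
  have m0 : 0 < Num.min (d / 2) tau by rewrite lt_min divr_gt0.
  have m1 : Num.min (d / 2) tau <= d / 2 by rewrite ge_min lexx.
  have m2 : Num.min (d / 2) tau <= tau by rewrite ge_min lexx orbT.
  have := Hd (tau - Num.min (d / 2) tau).
  rewrite /ball_/= opprB addrCA subrr addr0 gtr0_norm// => /(_ ltac:(lra)).
  rewrite ler_norml => /andP[_ h].
  have := below (tau - Num.min (d / 2) tau); lra.
have [d d0 Hd] := step tau tau0 ltac:(move=> r /andP[r0]; rewrite le_eqVlt =>
  /predU1P[->//|]; exact: below).
have : tau + d <= tau.
  apply: lb_le_inf => // r [r0 wr]; rewrite leNgt; apply/negP => rd.
  move: wr; rewrite ltNge => /negP; apply.
  have [rt|tr] := ltP r tau; first exact: below.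
  rewrite -(subrK tau r) addrC; apply: Hd; rewrite subr_ge0 tr/=; lra.
by rewrite gerDl leNgt d0.
Qed.

(** No derivative is given at time 0, so the mean value theorem is applied on [t, t + s], whose
    interior avoids 0, coordinate by coordinate. *)
Lemma right_increment (R : realType) n (h : 'rV[R]_n -> 'rV[R]_n)
    (x : R -> 'rV[R]_n) (t e : R) : continuous h -> continuous x ->
  (forall s : R, 0 < s -> is_derive s 1 x (h (x s))) -> 0 <= t -> 0 < e ->
  exists2 d, 0 < d &
    forall s, 0 <= s <= d -> `|x (t + s) - (x t + s *: h (x t))| <= e * s.
Proof.
move=> ch cx Dx t0 e0.
have chx : {for t, continuous (h \o x)}.
  by apply: continuous_comp; [exact: cx|exact: ch].
have : \forall r \near t, `|h (x t) - h (x r)| <= e.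
  by move/cvgrPdist_le : chx; exact.
move=> [d /= d0 Hd]; exists (d / 2); first by rewrite divr_gt0.
move=> s /andP[]; rewrite le_eqVlt => /predU1P[<-|s0] sd.
  by rewrite addr0 scale0r addr0 subrr normr0 mulr0.
apply: rV_norm_le => [|i]; first by rewrite mulr_ge0// ltW.
have tts : t < t + s by rewrite ltrDl.
have [||xi] := @MVT R (fun r => x r ord0 i) (fun r => h (x r) ord0 i) t (t + s) tts.
- move=> r; rewrite in_itv/= => /andP[tr _].
  by apply: (is_derive_rV _ _ _).1; apply: Dx; exact: le_lt_trans tr.
- apply: continuous_subspaceT => r.
  exact: (cvg_rV _ _ _).1 (cx r) i.
rewrite in_itv/= => /andP[x1 x2] E.
rewrite !mxE opprD addrA E (addrC t s) addrK mulrC -mulrBr normrM mulrC.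
rewrite (gtr0_norm s0) ler_wpM2r ?(ltW s0)//.
have := Hd xi; rewrite /ball_/= ltr0_norm ?subr_lt0// => /(_ ltac:(lra)).
apply: le_trans; rewrite distrC.
by have := rV_norm_ge (h (x t) - h (x xi)) i; rewrite !mxE.
Qed.

Lemma dini_decrease (R : realType) n (K c d : R) (V : 'rV[R]_n -> R)
    (h : 'rV[R]_n -> 'rV[R]_n) (x : R -> 'rV[R]_n) (t : R) :
  0 <= K -> lipR K V -> continuous h -> continuous x ->
  (forall s : R, 0 < s -> is_derive s 1 x (h (x s))) -> 0 <= t -> 0 < c ->
  h (x t) != 0 -> 0 < d ->
  (forall y, `|y - x t| < d -> differentiable V y ->
    dot (h (x t)) (gradient V y) <= - (2 * c)) ->
  exists2 d', 0 < d' &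
    forall s, 0 <= s <= d' -> V (x (t + s)) + c * s <= V (x t).
Proof.
move=> K0 VK ch cx Dx t0 c0 hx0 d0 Hd.
have [s0 s00 Hs] := lipR_slope_le VK hx0 d0 Hd.
have K1 : 0 < K + 1 by rewrite ltr_wpDl.
(* Of the slope [- (2 * c)] along the tangent, one [c] pays for the distance from tangent to
   trajectory, amplified by [K]. *)
have [d1 d10 Hd1] := right_increment ch cx Dx t0 (divr_gt0 c0 K1).
exists (Num.min (s0 / 2) d1); first by rewrite lt_min divr_gt0.
move=> s /andP[sge0]; rewrite le_min => /andP[ss sd].
have h1 := Hs s sge0 ltac:(lra).
have h2 := Hd1 s ltac:(by rewrite sge0).
have h3 := VK (x (t + s)) (x t + s *: h (x t)).
have h4 : K * `|x (t + s) - (x t + s *: h (x t))| <= c * s.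
  apply: (@le_trans _ _ ((K + 1) * (c / (K + 1) * s))).
    by apply: ler_pM => //; rewrite lerDl.
  by rewrite mulrA mulrCA mulfV ?gt_eqF// mulr1.
by move: (le_trans h3 h4); rewrite ler_norml => /andP[_ h5]; lra.
Qed.

(** Points of [C] violating the bounds -1/(k+1) would cluster at some [x] in [C]. Slopes along [h x]
    are at most [m / 2] near [x], and replacing [h x] by the field at a nearby point costs at most
    [- m / 4]. Only [c] is uniform; the radius may depend on the point. *)
Lemma uniform_slope (R : realType) n (q : \bar R) (K L : R)
    (V : 'rV[R]_n -> R) (h : 'rV[R]_n -> 'rV[R]_n) (C : set 'rV[R]_n) :
  (1 <= q)%E -> 0 <= K -> lipR K V -> 0 < L ->
  (forall x y, `|h x - h y| <= L * `|x - y|) -> compact C ->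
  (forall x, C x -> exists2 m, m < 0 &
     forall g, clarke_gradient q V x g -> dot (h x) g <= m) ->
  exists2 c, 0 < c & forall x, C x -> exists2 d, 0 < d &
    forall y, `|y - x| < d -> differentiable V y ->
      dot (h x) (gradient V y) <= - c.
Proof.
move=> q1 K0 VK L0 hL cC Hm; apply: contrapT => H.
have /choice[y Hy] : forall k : nat, exists x, C x /\ ~ exists2 d, 0 < d &
    forall y, `|y - x| < d -> differentiable V y ->
      dot (h x) (gradient V y) <= - k.+1%:R^-1.
  move=> k; apply: contrapT => Hk; apply: H; exists k.+1%:R^-1; first by rewrite invr_gt0.
  move=> x Cx; apply: contrapT => h'; apply: Hk; by exists x.
have [|x [Cx clx]] := cC (y k @[k --> \oo]) _ _.
  by exists 0%N => // k _ /=; have [] := Hy k.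
have [m m0 xm] := Hm x Cx.
have mm : m < m / 2 by rewrite ltr_pdivlMr//; lra.
have [d d0 Hd] := clarke_gradient_slope q1 K0 VK mm xm.
have D0 : 0 < n%:R * L * K + 1 by rewrite ltr_wpDl// !mulr_ge0// ltW.
(* The first term puts the ball of radius [d / 2] around [y k] inside that of radius [d] around [x];
   the second bounds the effect of moving the field from [x] to [y k]. *)
pose r := Num.min (d / 2) ((- m / 4) / (n%:R * L * K + 1)).
have m4 : 0 < - m / 4 by rewrite divr_gt0// oppr_gt0.
have r0 : 0 < r by rewrite lt_min; apply/andP; split; exact: divr_gt0.
have r1 : r <= d / 2 by rewrite ge_min lexx.
have r2 : r * (n%:R * L * K + 1) <= - m / 4.
  by rewrite -ler_pdivlMr// ge_min lexx orbT.
pose N := Num.truncn (- m / 4)^-1.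
have [||z [[k Nk <-] xz]] := clx [set y k | k in [set k | (N <= k)%N]] (ball x r).
- by exists N => // k /= Nk; exists k.
- exact: nbhsx_ballx.
have [_] := Hy k; apply; exists (d / 2); first by rewrite divr_gt0.
have {}xz : `|x - y k| < r by move: xz; rewrite -ball_normE.
move=> w wy dw.
have wx : `|w - x| < d.
  have := ler_distD (y k) w x; rewrite (distrC (y k)); lra.
have h1 := Hd w wx dw.
have h2 : dot (h (y k)) (gradient V w) = dot (h x) (gradient V w)
    - dot (h x - h (y k)) (gradient V w) by rewrite dotBl; lra.
have h3 : `|dot (h x - h (y k)) (gradient V w)| <= r * (n%:R * L * K + 1).
  apply: le_trans (dot_norm_le _ _) _.
  apply: (@le_trans _ _ (n%:R * (L * r) * K)).
    apply: ler_pM; rewrite ?mulr_ge0//; last exact: lipR_gradient_le.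
    by rewrite ler_wpM2l// (le_trans (hL _ _))// ler_wpM2l// ltW.
  by rewrite mulrDr mulr1 mulrA mulrAC [r * _]mulrC lerDl ltW.
have h4 : k.+1%:R^-1 < - m / 4.
  rewrite invf_plt ?posrE//; apply: lt_le_trans (truncnS_gt _) _.
  by rewrite ler_nat ltnS.
have := le_trans h3 r2; rewrite ler_norml => /andP[{}h3 _].
by move: h1 h2 h3 h4; set ik := k.+1%:R^-1; set Dh := dot (h x - _) _; lra.
Qed.

Theorem theorem4 (R : realType) (d : nat) (q : \bar R) (hq : (1 <= q)%E)
    (X : set 'rV[R]_d) (hXo : open X) (hXb : bounded_set X)
    (f : 'rV[R]_d -> 'rV[R]_d)
    (hflip : lipschitz_on_vf q X f)
    (hfeq : [set x | X x /\ f x = 0] = [set 0])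
    (hstab : origin_locally_asymptotically_stable q X f)
    (n : nat) (xs fs : 'I_n -> 'rV[R]_d)
    (hD : forall i, X (xs i) /\ fs i = f (xs i))
    (F : 'rV[R]_d -> set 'rV[R]_d)
    (hF : forall x, X x -> [/\ compact (F x), convex_set (F x) & F x (f x)])
    (A : set 'rV[R]_d) (hAc : compact A)
    (hAR : A `<=` interior (region_of_attraction q X f))
    (hA0 : interior A 0)
    (V : 'rV[R]_d -> R) (hV : lipschitz_fun q V)
    (hVF : forall x, (X `\` A) x ->
       exists2 m, is_max (clarke_lie q V F x) m & m < 0) :
  forall a : R, sublevel V a `<=` X ->
    sublevel V a `<=` region_of_attraction q X f.
Proof.
move=> a aX x0 x0a.
have [K K0 VK] := lipschitz_fun_lipR hq hV.
have [L L0 fL] : exists2 L, 0 < L &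
    forall x y, X x -> X y -> `|f x - f y| <= L * `|x - y|.
  have [L fL] := hflip; have [C C0 HC] := qnorm_le_norm d hq.
  exists (`|L| * C + 1) => [|x y Xx Xy].
    by rewrite ltr_wpDl// mulr_ge0// ltW.
  apply: le_trans (norm_le_qnorm _ hq) _; apply: le_trans (fL _ _ Xx Xy) _.
  apply: (@le_trans _ _ (`|L| * qnorm q (x - y))).
    by rewrite ler_wpM2r ?ler_norm// (le_trans _ (norm_le_qnorm _ hq)).
  apply: (@le_trans _ _ (`|L| * C * `|x - y|)); first by rewrite -mulrA ler_wpM2l.
  by rewrite ler_wpM2r// lerDl.
have [h [hL hf]] := lipschitz_extension (ltW L0) (ex_intro _ x0 (aX _ x0a)) fL.
have ch : continuous h.
  move=> x; apply/(@cvgrPdist_le _ _ _ _ (nbhs_filter x)) => e e0; near=> y.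
  apply: le_trans (hL x y) _; rewrite mulrC -ler_pdivlMr//.
  by near: y; apply: cvgr_dist_le => //; exact: divr_gt0.
have [x [cx xE Dx]] := global_solution x0 L0 hL.
have cV := lipR_continuous VK.
pose ROA := region_of_attraction q X f.
(* By uniqueness, the path after time [s] is the attracted solution from [x s], so it is enough to
   reach the region without leaving [X] before. *)
suff [s s0 [xs_roa xsX]] : exists2 s, 0 <= s &
    ROA (x s) /\ forall r, 0 <= r <= s -> X (x r).
  have [y [y0 yX cy Dy] y_cvg] := xs_roa.
  have xy t : 0 <= t -> x (s + t) = y t.
    apply: (@solution_unique _ _ h L (fun t => x (s + t)) y) => //.
    - apply: continuous_subspaceT => r.
      apply: (@continuous_comp _ _ _ (fun t : R => s + t) x); last exact: cx.
      by apply: cvgD; [exact: cvg_cst|exact: cvg_id].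
    - by rewrite addr0 y0.
    - move=> v v0; have sv : 0 < s + v by rewrite ltr_wpDl.
      have /is_deriveP H := Dx _ sv; apply/is_deriveP.
      suff -> : (fun r : R => r^-1 *: (x (s + (r + v)) - x (s + v))) =
         (fun r => r^-1 *: (x (r + (s + v)) - x (s + v))) by [].
      by apply/funext => r; rewrite addrCA.
    - by move=> v v0; rewrite hf; [exact: Dy|exact/yX/ltW].
  have xX t : 0 <= t -> X (x t).
    move=> t0; have [ts|st] := leP t s; first by apply: xsX; rewrite t0.
    by rewrite -(subrKC s t) xy ?subr_ge0 ?ltW//; apply: yX; rewrite subr_ge0 ltW.
  exists x.
    split => //; first exact: continuous_subspaceT.
    by move=> t t0; rewrite -hf; [exact: Dx|exact/xX/ltW].
  apply/cvgrPdist_le => e e0.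
  have /cvgrPdist_le/(_ _ e0)[M [_ HM]] := y_cvg.
  exists (Num.max M 0 + s); split; first exact: num_real.
  move=> t Mt; have tM : Num.max M 0 < t - s by rewrite ltrBrDr.
  rewrite -(subrKC s t) xy; last by apply: ltW; apply: le_lt_trans tM; rewrite le_max lexx orbT.
  by apply: HM; apply: le_lt_trans tM; rewrite le_max lexx.
apply: contrapT => noroa.
pose b := V x0.
pose C := [set y | V y <= b] `&` ~` interior ROA.
have CX : C `<=` X by move=> y [Vy _]; apply: aX; exact: le_lt_trans Vy x0a.
have cC : compact C.
  apply: bounded_closed_compact.
    have [M [Mreal HM]] := hXb.
    by exists M; split => // r Mr y /CX; exact: HM Mr y.
  apply: closedI; first exact: closed_sublevel.
  by apply: open_closedC; exact: open_interior.
have Cneg y : C y -> exists2 m, m < 0 &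
    forall g, clarke_gradient q V y g -> dot (h y) g <= m.
  move=> Cy; have Xy := CX _ Cy.
  have nA : ~ A y by move=> /hAR; case: Cy.
  have [m [_ mmax] m0] := hVF y (conj Xy nA); exists m => // g Hg.
  apply: mmax; exists (h y); first by rewrite hf//; have [] := hF y Xy.
  by exists g.
(* The only equilibrium lies in [A], hence in the removed set. *)
have Cneq0 y : C y -> h y != 0.
  move=> Cy; have Xy := CX _ Cy; rewrite hf//; apply/eqP => fy0.
  have : [set x | X x /\ f x = 0] y by [].
  rewrite hfeq => /= y0; case: Cy => _; apply; apply: hAR; rewrite y0.
  exact: interior_subset hA0.
have [c c0 Hc] := uniform_slope hq K0 VK L0 hL cC Cneg.
have c20 : 0 < c / 2 by rewrite divr_gt0.
(* The rate is half the uniform slope [c], the other half being lost in [dini_decrease]. *)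
have decr t : 0 <= t -> V (x t) + c / 2 * t <= b.
  apply: (@real_induction _ (fun t => V (x t) + c / 2 * t)).
  - move=> r; apply: cvgD.
      by apply: (@continuous_comp _ _ _ x V); [exact: cx|exact: cV].
    by apply: cvgM; [exact: cvg_cst|exact: cvg_id].
  - by rewrite mulr0 addr0 xE.
  move=> r r0 Hr.
  have Vr u : 0 <= u <= r -> V (x u) <= b.
    move=> ur; apply: le_trans (Hr u ur); rewrite lerDl.
    by case/andP: ur => u0 _; apply: mulr_ge0 => //; exact: ltW.
  (* The bound on the past keeps the path in [X]; entering the interior of the region at time [r]
     would then contradict [noroa]. *)
  have Cxr : C (x r).
    split; first by apply: Vr; rewrite r0 lexx.
    move=> /interior_subset xroa; apply: noroa; exists r => //; split => // u ur.
    by apply: aX; exact: le_lt_trans (Vr u ur) x0a.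
  have [e e0 He] := Hc _ Cxr.
  have [|e' e'0 He'] := @dini_decrease _ _ K (c / 2) e V h x r K0 VK ch cx Dx r0 c20 (Cneq0 _ Cxr) e0.
    by move=> y yx dV; rewrite (_ : 2 * (c / 2) = c); [exact: He|field].
  exists e' => // u ue; have := He' u ue.
  by have := Hr r; rewrite r0 lexx => /(_ erefl); lra.
have [M HM] : exists M, forall y, X y -> - M <= V y.
  have [M [_ HM]] := hXb.
  exists (`|V 0| + K * (`|M| + 1)) => y Xy.
  have /= yM := HM (`|M| + 1) (ltr_pwDr ltr01 (ler_norm _)) y Xy.
  have := VK 0 y; rewrite sub0r normrN => h1.
  have := le_trans h1 (ler_wpM2l K0 yM).
  rewrite ler_norml => /andP[_ h2]; have := ler_norm (- V 0); rewrite normrN; lra.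
(* By this time the guaranteed decrease brings [V] below [- M]. *)
pose t := (`|b| + `|M| + 1) / (c / 2).
have t0 : 0 <= t by rewrite divr_ge0 ?addr_ge0// ltW.
have := decr t t0; rewrite /t mulrCA mulfV ?gt_eqF// mulr1 -/t => h1.
have Vt : V (x t) <= b.
  by have := ler_norm b; have := normr_ge0 M; have := normr_ge0 b; lra.
have := HM (x t) (aX _ (le_lt_trans Vt x0a)).
by have := ler_norm b; have := ler_norm M; lra.
Unshelve. all: by end_near. Qed.
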